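(* Let $Y$, $x$, $T$ be as in the context, and let $W$ be an irreducible $T$-module with endpoint $r$, dual endpoint $t$ and diameter $d$. If $d=0$ then $c^*_0(W)=0$, $a^*_0(W)=\theta^*_r$, $b^*_0(W)=0$. If $d\ge1$ then $c^*_0(W)=0$, $c^*_i(W)=\dfrac{(\theta^2_{t+i}-\theta^2_t)(\theta^*_{r+2}-\theta^*_{r+1})+(\theta_t\theta_{t+1}-\theta_{t+i}\theta_{t+i+1})(\theta^*_{r+1}-\theta^*_r)}{(\theta_{t+i-1}-\theta_{t+i})(\theta_{t+i-1}-\theta_{t+i+1})}$ for $1\le i\le d-1$, $c^*_d(W)=\dfrac{\theta_{t+d}(\theta^*_{r+1}-\theta^*_r)}{\theta_{t+d-1}-\theta_{t+d}}$, $b^*_0(W)=\dfrac{\theta_t(\theta^*_r-\theta^*_{r+1})}{\theta_t-\theta_{t+1}}$, $b^*_i(W)=\dfrac{(\theta^2_{t+i}-\theta^2_t)(\theta^*_{r+2}-\theta^*_{r+1})+(\theta_t\theta_{t+1}-\theta_{t+i}\theta_{t+i-1})(\theta^*_{r+1}-\theta^*_r)}{(\theta_{t+i+1}-\theta_{t+i})(\theta_{t+i+1}-\theta_{t+i-1})}$ for $1\le i\le d-1$, $b^*_d(W)=0$, $a^*_i(W)=\theta^*_r-b^*_i(W)-c^*_i(W)$ for $0\le i\le d$. In particular $c^*_i(W),a^*_i(W),b^*_i(W)$ are real for $0\le i\le d$.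
   Context: $Y=(X,\{R_i\}_{0\le i\le D})$ is a symmetric association scheme ($X$ finite; $R_i$ partition $X\times X$, $R_0$ diagonal, $R_i$ symmetric; $p^h_{ij}=|\{z:(x,z)\in R_i,(z,y)\in R_j\}|$ for $(x,y)\in R_h$ independent of $x,y$), with $D\ge3$, associate matrices $A_i$ ($(A_i)_{xy}=1$ iff $(x,y)\in R_i$), Bose–Mesner algebra $M=\mathrm{span}\{A_i\}$ with primitive idempotents $E_0,\dots,E_D$ ($E_iE_j=\delta_{ij}E_i$, $\sum E_i=I$, $E_0=|X|^{-1}J$), Krein parameters $q^h_{ij}$ ($E_i\circ E_j=|X|^{-1}\sum_hq^h_{ij}E_h$). $Y$ is P-polynomial w.r.t. $R_0,\dots,R_D$ ($p^h_{ij}=0$ if one of $h,i,j$ exceeds the sum of the other two, $\ne0$ if it equals that sum), almost-bipartite ($p^i_{1i}=0$ for $0\le i\le D-1$, $p^D_{1D}\ne0$), and Q-polynomial w.r.t. $E_0,\dots,E_D$ (same conditions for $q^h_{ij}$). $A=A_1$, $AE_i=\theta_iE_i$. Fix $x\in X$: $E^*_i$ diagonal with $(E^*_i)_{yy}=1$ iff $(x,y)\in R_i$; $A^*$ diagonal with $(A^* )_{yy}=|X|(E_1)_{xy}$; $A^*E^*_i=\theta^*_iE^*_i$. Set $E_i=0$ for $i\notin[0,D]$. $T=T(x)$ is generated by $M$ and $\mathrm{span}\{E^*_i\}$. $R^*=\sum_iE_{i+1}A^*E_i$, $F^*=\sum_iE_iA^*E_i$, $L^*=\sum_iE_{i-1}A^*E_i$.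 For an irreducible $T$-module $W\subseteq\mathbb{C}^X$: endpoint $r=\min\{i:E^*_iW\neq0\}$, dual endpoint $t=\min\{i:E_iW\ne0\}$, diameter $d=|\{i:E^*_iW\ne0\}|-1$. In this setting every irreducible $W$ is thin and dual thin ($\dim E^*_iW\le1$, $\dim E_iW\le 1$ for all $i$); the dual intersection numbers $c^*_i(W),a^*_i(W),b^*_i(W)$ ($0\le i\le d$) are the scalars with $R^*E_{t+i-1}v=c^*_i(W)E_{t+i}v$, $F^*E_{t+i}v=a^*_i(W)E_{t+i}v$, $L^*E_{t+i+1}v=b^*_i(W)E_{t+i}v$ for any nonzero $v\in E^*_rW$ (independent of $v$). *)

(* Defs.v *)
From HB Require Import structures.
From mathcomp Require Import all_boot all_order all_algebra.
From mathcomp Require classical_sets.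
From mathcomp Require Export reals complex.

Set Implicit Arguments.
Unset Strict Implicit.
Unset Printing Implicit Defensive.

Import Order.TTheory GRing.Theory Num.Theory.
Local Open Scope ring_scope.

(* A family indexed by 0, ..., D, extended by zero to all integers, as in the
   convention E_i = 0 for i outside [0, D].  Integer indices avoid truncated
   subtraction in E_{t+i-1}. *)
Definition zext (D : nat) (V : nmodType) (f : 'I_D.+1 -> V) (k : int) : V :=
  if k is Posz n then (if insub n is Some i then f i else 0) else 0.

Record assoc_scheme (X : finType) (D : nat) := AssocScheme {
  srel : 'I_D.+1 -> {set X * X};
  (* pnum h i j is p^h_{ij} *)
  pnum : 'I_D.+1 -> 'I_D.+1 -> 'I_D.+1 -> nat;
  srel_neq0 : forall i, srel i != set0;
  srel_part : forall x y, exists! i, (x, y) \in srel i;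
  srel_diag : forall x y, ((x, y) \in srel ord0) = (x == y);
  srel_sym : forall i x y, ((x, y) \in srel i) = ((y, x) \in srel i);
  pnumP : forall h i j x y, (x, y) \in srel h ->
    #|[set z | ((x, z) \in srel i) && ((z, y) \in srel j)]| = pnum h i j
}.

(* The vanishing conditions shared by the P-polynomial property (f = p) and the
   Q-polynomial property (f = q); f h i j stands for p^h_{ij} or q^h_{ij}. *)
Definition polynomial_numbers (D : nat) (V : nmodType)
    (f : 'I_D.+1 -> 'I_D.+1 -> 'I_D.+1 -> V) : Prop :=
  forall h i j : 'I_D.+1,
    ([|| i + j < h, h + j < i | h + i < j]%N -> f h i j = 0) /\
    ([|| h == i + j :> nat, i == h + j :> nat | j == h + i :> nat]%N ->
       f h i j <> 0).

Definition P_polynomial (X : finType) (D : nat) (Y : assoc_scheme X D) : Prop :=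
  polynomial_numbers (pnum Y).

Definition almost_bipartite (X : finType) (D : nat) (Y : assoc_scheme X D) :
    Prop :=
  (forall i : 'I_D.+1, (i < D)%N -> pnum Y i (inord 1) i = 0%N) /\
  pnum Y ord_max (inord 1) ord_max <> 0%N.

Section BoseMesner.
Variables (C : numClosedFieldType) (X : finType) (D : nat).
Variable Y : assoc_scheme X D.

(* Matrices with rows and columns indexed by X, through enum_val; C^X is
   'cV[C]_#|X|. *)
Definition assoc_mx (i : 'I_D.+1) : 'M[C]_#|X| :=
  \matrix_(y, z) ((enum_val y, enum_val z) \in srel Y i)%:R.

Definition bose_mesner : {vspace 'M[C]_#|X|} := <<codom assoc_mx>>%VS.

(* D + 1 orthogonal idempotents forming a basis of the (D + 1)-dimensional
   commutative algebra M; these are its primitive idempotents, listed with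
   E_0 = |X|^{-1} J first. *)
Definition primitive_idempotents (E : 'I_D.+1 -> 'M[C]_#|X|) : Prop :=
  [/\ basis_of bose_mesner (codom E),
      forall i j, E i *m E j = (if i == j then E i else 0),
      \sum_i E i = 1%:M
    & E ord0 = #|X|%:R^-1 *: const_mx 1].

(* q h i j is q^h_{ij}; map2_mx *%R is the entrywise product. *)
Definition krein_parameters (E : 'I_D.+1 -> 'M[C]_#|X|)
    (q : 'I_D.+1 -> 'I_D.+1 -> 'I_D.+1 -> C) : Prop :=
  forall i j,
    map2_mx *%R (E i) (E j) = #|X|%:R^-1 *: \sum_h q h i j *: E h.

Definition adj_mx : 'M[C]_#|X| := zext assoc_mx 1.

Section Terwilliger.
Variables (x : X) (E : 'I_D.+1 -> 'M[C]_#|X|).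

Definition dual_idem (i : 'I_D.+1) : 'M[C]_#|X| :=
  diag_mx (\row_y ((x, enum_val y) \in srel Y i)%:R).

Definition dual_adj_mx : 'M[C]_#|X| :=
  diag_mx (\row_y (#|X|%:R * (zext E 1) (enum_rank x) y)).

Inductive terwilliger : 'M[C]_#|X| -> Prop :=
| terwilliger_BM B : B \in bose_mesner -> terwilliger B
| terwilliger_dual i : terwilliger (dual_idem i)
| terwilliger_add B1 B2 :
    terwilliger B1 -> terwilliger B2 -> terwilliger (B1 + B2)
| terwilliger_scale (a : C) B : terwilliger B -> terwilliger (a *: B)
| terwilliger_mul B1 B2 :
    terwilliger B1 -> terwilliger B2 -> terwilliger (B1 *m B2).

Definition T_module (W : {vspace 'cV[C]_#|X|}) : Prop :=
  forall B, terwilliger B -> forall v, v \in W -> B *m v \in W.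

Definition irreducible_T_module (W : {vspace 'cV[C]_#|X|}) : Prop :=
  [/\ T_module W, W <> 0%VS
    & forall U : {vspace 'cV[C]_#|X|},
        T_module U -> (U <= W)%VS -> U = 0%VS \/ U = W].

Definition mx_img (B : 'M[C]_#|X|) (W : {vspace 'cV[C]_#|X|}) :
    {vspace 'cV[C]_#|X|} :=
  (linfun (mulmx B) @: W)%VS.

(* enum 'I_D.+1 is 0, ..., D in increasing order, so find returns the least
   index with the required property. *)
Definition endpoint (W : {vspace 'cV[C]_#|X|}) : nat :=
  find (fun i => mx_img (dual_idem i) W != 0%VS) (enum 'I_D.+1).

Definition dual_endpoint (W : {vspace 'cV[C]_#|X|}) : nat :=
  find (fun i => mx_img (E i) W != 0%VS) (enum 'I_D.+1).

Definition diameter (W : {vspace 'cV[C]_#|X|}) : nat :=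
  (#|[set i | mx_img (dual_idem i) W != 0%VS]| - 1)%N.

Definition dual_raising : 'M[C]_#|X| :=
  \sum_(i < D.+1) zext E (i%:Z + 1) *m dual_adj_mx *m E i.

Definition dual_flat : 'M[C]_#|X| :=
  \sum_(i < D.+1) E i *m dual_adj_mx *m E i.

Definition dual_lowering : 'M[C]_#|X| :=
  \sum_(i < D.+1) zext E (i%:Z - 1) *m dual_adj_mx *m E i.

(* The scalar a with B E_k v = a E_l v for all nonzero v in E*_r W, where r is
   the endpoint of W (and 0 if there is no such scalar). *)
Definition dual_scalar (W : {vspace 'cV[C]_#|X|}) (B : 'M[C]_#|X|)
    (k l : int) : C :=
  classical_sets.xget 0 (fun a : C => forall v : 'cV[C]_#|X|,
    v \in mx_img (zext dual_idem (endpoint W)%:Z) W -> v != 0 ->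
    B *m (zext E k *m v) = a *: (zext E l *m v)).

Definition dual_c (W : {vspace 'cV[C]_#|X|}) (i : nat) : C :=
  let t := (dual_endpoint W)%:Z in
  dual_scalar W dual_raising (t + i%:Z - 1) (t + i%:Z).

Definition dual_a (W : {vspace 'cV[C]_#|X|}) (i : nat) : C :=
  let t := (dual_endpoint W)%:Z in
  dual_scalar W dual_flat (t + i%:Z) (t + i%:Z).

Definition dual_b (W : {vspace 'cV[C]_#|X|}) (i : nat) : C :=
  let t := (dual_endpoint W)%:Z in
  dual_scalar W dual_lowering (t + i%:Z + 1) (t + i%:Z).

End Terwilliger.
End BoseMesner.

(* Main.v *)
(* Let v be a nonzero vector of E*_r W, r the endpoint, that is an eigenvector of
   E*_r A^2 (of E*_r A if r = D).  As Y is almost bipartite, A v lies in E*_(r+1) W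
   and A^2 v in C v + E*_(r+2) W (with r + 1 in place of r + 2 if r = D - 1), so A*
   acts on A^j v, j <= 2, in a known way.  Since E_k A* E_l = 0 for |k - l| > 1,
   each E_k gives three linear equations for E_k A* E_l v, |k - l| <= 1, whose
   matrix is a Vandermonde matrix in the eigenvalues of A.  Hence all these vectors
   are multiples of E_k v and M v is a T-module, equal to W by irreducibility.
   Then W is dual thin, A* is irreducible tridiagonal on it, so that E_t v generates
   W under A* and W is thin; the three equations, with the unknown eigenvalue
   eliminated by means of the case k = t, give the dual intersection numbers. *)

Require Import Defs.
From mathcomp Require Import all_boot all_order all_algebra.
From mathcomp Require Import ring zify.

Set Implicit Arguments.
Unset Strict Implicit.
Unset Printing Implicit Defensive.

Import Order.TTheory GRing.Theory Num.Theory.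
Local Open Scope ring_scope.

(** * Subspaces stable under a matrix *)

Section StableSubspaces.
Variables (F : closedFieldType) (n : nat).
Implicit Types (B : 'M[F]_n) (U W : {vspace 'cV[F]_n}) (v w : 'cV[F]_n).

Definition mxstable B U := forall v, v \in U -> B *m v \in U.

Lemma mxstable_sum_line (I : finType) (w : I -> 'cV[F]_n) B U :
  (forall i, B *m w i \in U) ->
  forall v, v \in (\sum_i <[w i]>)%VS -> B *m v \in U.
Proof.
move=> hB v /memv_sumP [u hu ->]; rewrite mulmx_sumr; apply: memv_suml => i _.
by have /vlineP [a ->] := hu i isT; rewrite -scalemxAr memvZ.
Qed.

Lemma mem_sum_line (I : finType) (w : I -> 'cV[F]_n) i :
  w i \in (\sum_i <[w i]>)%VS.
Proof.
by rewrite memvE; apply: (sumv_sup (P := xpredT) (Vs := fun i => <[w i]>%VS) i).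
Qed.

Lemma mxstable_lincomb (I : finType) (P : I -> 'M[F]_n) (beta : I -> F) U :
  (forall i, mxstable (P i) U) -> mxstable (\sum_i beta i *: P i) U.
Proof.
move=> hP v vU; rewrite mulmx_suml memv_suml // => i _.
by rewrite -scalemxAl memvZ // hP.
Qed.

End StableSubspaces.

(** By Cayley-Hamilton the product of the factors [G - z], over the roots [z] of the characteristic
    polynomial, kills [v]. When the factors act one after another, the last nonzero vector is an
    eigenvector; it lies in [U], which every factor preserves. *)
Lemma stable_eigenvector (F : closedFieldType) (n : nat) (G : 'M[F]_n)
    (U : {vspace 'cV[F]_n}) (v : 'cV[F]_n) :
  mxstable G U -> v \in U -> v != 0 ->
  exists a w, [/\ w \in U, w != 0 & G *m w = a *: w].
Proof.
case: n G U v => [|m] G U v hG vU v0.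
  by case/eqP: v0; apply/matrixP => - [].
have hCH := Cayley_Hamilton G.
have [s hs] := closed_field_poly_normal (char_poly G).
rewrite hs (monicP (char_poly_monic G)) scale1r rmorph_prod /= in hCH.
have {hCH} : (\prod_(z <- s) horner_mx G ('X - z%:P)) *m v = 0 by rewrite hCH mul0mx.
have -> : \prod_(z <- s) horner_mx G ('X - z%:P) = \prod_(z <- s) (G - z%:M).
  by apply: eq_bigr => z _; rewrite rmorphB /= horner_mx_X horner_mx_C.
(* Reversing the list lets the induction remove the rightmost factor, the first to act on [v]. *)
rewrite -[s]revK; elim: (rev s) v vU v0 => [|z s' IH] v vU v0.
  by rewrite big_nil mul1mx => vz; rewrite vz eqxx in v0.
rewrite rev_cons -cats1 big_cat /= big_seq1 -mulmxA.
have [Gz|Gn0] := eqVneq ((G - z%:M) *m v) 0.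
  exists z, v; split => //; apply/eqP; move/eqP: Gz.
  by rewrite mulmxBl mul_scalar_mx subr_eq0.
by apply: IH; rewrite // mulmxBl mul_scalar_mx memvB ?memvZ ?hG.
Qed.

(** * Orthogonal idempotents summing to the identity *)

Section IdempotentFamilies.
Variables (F : closedFieldType) (n : nat) (I : finType) (P : I -> 'M[F]_n).
Implicit Types (U W : {vspace 'cV[F]_n}) (v w : 'cV[F]_n).
Hypothesis P_mul : forall i j, P i *m P j = if i == j then P i else 0.
Hypothesis P_sum : \sum_i P i = 1%:M.

Lemma idem_sum v : v = \sum_i P i *m v.
Proof. by rewrite -mulmx_suml P_sum mul1mx. Qed.

Lemma idem_mulv i j v : P i *m (P j *m v) = if i == j then P i *m v else 0.
Proof. by rewrite mulmxA P_mul; case: ifP; rewrite ?mul0mx. Qed.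

Lemma mulmx_lincomb (beta : I -> F) B k :
  B = \sum_i beta i *: P i -> (B *m P k = beta k *: P k) * (P k *m B = beta k *: P k).
Proof.
move=> ->; split; rewrite ?mulmx_suml ?mulmx_sumr (bigD1 k) //= big1 ?addr0.
- by rewrite -scalemxAl P_mul eqxx.
- by move=> i /negPf ik; rewrite -scalemxAl P_mul ik scaler0.
- by rewrite -scalemxAr P_mul eqxx.
- by move=> i /negPf ik; rewrite -scalemxAr P_mul eq_sym ik scaler0.
Qed.

(** [P i] is a multiple of the Lagrange polynomial in [B] with factors [B - beta j], [j != i]: the
    factor for [j] kills [P j], and none kills [P i]. *)
Lemma mxstable_idem (beta : I -> F) U i :
  injective beta -> mxstable (\sum_i beta i *: P i) U -> mxstable (P i) U.
Proof.
move=> beta_inj; set B := \sum_i _ => hB v vU.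
have BP k : B *m P k = beta k *: P k by rewrite (mulmx_lincomb k (erefl B)).
have key (s : seq I) :
    \sum_k (\prod_(j <- s) (beta k - beta j)) *: (P k *m v) \in U.
  elim: s => [|j s IH].
    rewrite (eq_bigr (fun k => P k *m v)) -?idem_sum // => k _.
    by rewrite big_nil scale1r.
  set u := \sum_k _ in IH.
  have -> : \sum_k (\prod_(j0 <- j :: s) (beta k - beta j0)) *: (P k *m v) =
      B *m u - beta j *: u.
    rewrite mulmx_sumr scaler_sumr -sumrB; apply: eq_bigr => k _.
    rewrite big_cons -scalemxAr mulmxA BP -scalemxAl !scalerA -scalerBl.
    by congr (_ *: _); ring.
  by rewrite memvB ?memvZ ?hB.
have := key [seq j <- enum I | j != i].
rewrite (bigD1 i) //= [X in _ + X]big1 ?addr0 => [|k ki].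
  set a := (X in X *: _) => aU.
  suff a0 : a != 0 by rewrite -[P i *m v]scale1r -(mulVf a0) -scalerA memvZ.
  rewrite prodf_seq_neq0; apply/allP => j; rewrite mem_filter => /andP [ji _].
  by rewrite subr_eq0 (inj_eq beta_inj) eq_sym.
rewrite [X in X *: _](_ : _ = 0) ?scale0r //.
apply/eqP; rewrite prodf_seq_eq0; apply/hasP; exists k.
  by rewrite mem_filter ki mem_enum.
by rewrite /= subrr eqxx.
Qed.

(** Applying [P i] to a vanishing sum shows that the lines are independent. Used for two families on
    one space, the count equates the sizes of two supports. *)
Lemma dim_sum_idem_line v :
  \dim (\sum_i <[P i *m v]>)%VS = #|[set i | P i *m v != 0]|.
Proof.
have /directvP -> /= : directv (\sum_i <[P i *m v]>)%VS.
  apply/directv_sum_independent => us hus sum0 i _.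
  have e j : us j = P j *m us j.
    have /vlineP [a ->] := hus j isT.
    by rewrite -scalemxAr idem_mulv eqxx.
  have := congr1 (mulmx (P i)) sum0; rewrite mulmx0 mulmx_sumr (bigD1 i) //=.
  rewrite big1 ?addr0 -?e // => j /negPf ji.
  by rewrite e idem_mulv eq_sym ji.
rewrite -sum1_card [RHS]big_mkcond /=; apply: eq_bigr => i _.
by rewrite dim_vline inE; case: (_ != 0).
Qed.

Lemma sum_idem_line_sub W v :
  (forall i, mxstable (P i) W) -> v \in W -> (\sum_i <[P i *m v]> <= W)%VS.
Proof. by move=> hP vW; apply/subv_sumP => i _; rewrite -memvE hP. Qed.
End IdempotentFamilies.

(** Supplies the nodes [a], [b] for Lagrange interpolation at [l] among the neighbours of [k]. They
    coincide when [k] is 0 or [D], where a missing neighbour is replaced by one already present. *)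
Lemma ord_two_others (D : nat) (k l : 'I_D.+1) :
  (0 < D)%N -> (k <= l.+1)%N -> (l <= k.+1)%N ->
  exists a b : 'I_D.+1, [/\ a != l, b != l &
    forall m : 'I_D.+1, (k <= m.+1)%N -> (m <= k.+1)%N -> [|| m == l, m == a | m == b]].
Proof.
move=> D0 kl lk; have [kD lD] := (ltn_ord k, ltn_ord l).
pose nb j : 'I_D.+1 := inord j.
have nbE j : (j <= D)%N -> nb j = j :> nat by move=> jD; rewrite inordK.
case: (ltngtP l k) => [ltlk|ltkl|eqlk].
- exists k, (if k == D :> nat then k else nb k.+1); case: ifP => /eqP kD'.
    split; rewrite -?val_eqE /=; try lia.
    by move=> m mk km; have mD := ltn_ord m; rewrite -!val_eqE /=; lia.
  have nbk := nbE k.+1; split; rewrite -?val_eqE /=; try lia.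
  by move=> m mk km; have mD := ltn_ord m; rewrite -!val_eqE /=; lia.
- exists k, (if k == 0%N :> nat then k else nb k.-1); case: ifP => /eqP kD'.
    split; rewrite -?val_eqE /=; try lia.
    by move=> m mk km; have mD := ltn_ord m; rewrite -!val_eqE /=; lia.
  have nbk := nbE k.-1; split; rewrite -?val_eqE /=; try lia.
  by move=> m mk km; have mD := ltn_ord m; rewrite -!val_eqE /=; lia.
have nbk := nbE k.-1; have nbk' := nbE k.+1; have nb1 := nbE 1%N; have nbD := nbE D.-1.
exists (if k == 0%N :> nat then nb 1%N else nb k.-1).
exists (if k == D :> nat then nb D.-1 else nb k.+1).
case: ifP => /eqP k0; case: ifP => /eqP kD'; (split; rewrite -?val_eqE /=; try lia);
 by move=> m mk km; have mD := ltn_ord m; rewrite -!val_eqE /=; lia.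
Qed.

(** * Irreducible modules for a tridiagonal pair *)

Section TridiagonalModule.
Variables (F : closedFieldType) (n D : nat).
Variables (E Es : 'I_D.+1 -> 'M[F]_n) (th ths : 'I_D.+1 -> F).
Variable W : {vspace 'cV[F]_n}.
Variables A As : 'M[F]_n.
Hypothesis A_def : A = \sum_i th i *: E i.
Hypothesis As_def : As = \sum_i ths i *: Es i.
Hypothesis D_gt0 : (0 < D)%N.
Hypothesis E_mul : forall i j, E i *m E j = if i == j then E i else 0.
Hypothesis E_sum : \sum_i E i = 1%:M.
Hypothesis Es_mul : forall i j, Es i *m Es j = if i == j then Es i else 0.
Hypothesis Es_sum : \sum_i Es i = 1%:M.
Hypotheses (th_inj : injective th) (ths_inj : injective ths).
Hypothesis E_As_E : forall k l : 'I_D.+1,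
  (k.+1 < l)%N || (l.+1 < k)%N -> E k *m As *m E l = 0.
Hypothesis Es_A_Es : forall i j : 'I_D.+1,
  [|| (i.+1 < j)%N, (j.+1 < i)%N | (i == j) && (i < D)%N] -> Es i *m A *m Es j = 0.
Hypothesis W_E : forall i, mxstable (E i) W.
Hypothesis W_Es : forall i, mxstable (Es i) W.
Hypothesis W_irr : forall U : {vspace 'cV[F]_n}, (U <= W)%VS ->
  (forall i, mxstable (E i) U) -> (forall i, mxstable (Es i) U) -> U = 0%VS \/ U = W.
Variable r : 'I_D.+1.
Hypothesis W_r : exists2 u, u \in W & Es r *m u != 0.
Hypothesis W_lt_r : forall (i : 'I_D.+1) u, (i < r)%N -> u \in W -> Es i *m u = 0.

Let E_A k : E k *m A = th k *: E k. Proof. by rewrite (mulmx_lincomb E_mul k A_def). Qed.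
Let As_Es k : As *m Es k = ths k *: Es k.
Proof. by rewrite (mulmx_lincomb Es_mul k As_def). Qed.
Let W_A : mxstable A W. Proof. by rewrite A_def; apply: mxstable_lincomb. Qed.

(** [Es r *m G] maps the nonzero space E*_r W to itself. Below, [G] is [A] if [r = D] and [A *m A]
    otherwise. *)
Let Es_r_eigenvector (G : 'M[F]_n) : mxstable G W ->
  exists a v, [/\ v \in W, v != 0, Es r *m v = v & Es r *m G *m v = a *: v].
Proof.
move=> hG; have [u uW u0] := W_r.
pose U := (linfun (mulmx (Es r)) @: W)%VS.
have UP v : v \in U -> v \in W /\ Es r *m v = v.
  case/memv_imgP => w wW ->; rewrite lfunE /=; split; first exact: W_Es.
  by rewrite (idem_mulv Es_mul) eqxx.
have inU w : w \in W -> Es r *m w \in U.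
  by move=> wW; apply/memv_imgP; exists w; rewrite ?lfunE.
have [|a [v [/UP [vW rv] v0 e]]] :=
    @stable_eigenvector _ _ (Es r *m G) U (Es r *m u) _ (inU _ uW) u0.
- by move=> v /UP [vW _]; rewrite -mulmxA inU // hG.
by exists a, v.
Qed.

(** For r < D, [mu] is the eigenvalue of E*_r A^2 at [v]. The equations conditional on [s] give the
    exact coefficients; the last two also cover r = D - 1 and r = D and are what the interpolation
    needs. *)
Lemma endpoint_vector : exists v, [/\ v \in W, v != 0, Es r *m v = v,
  (exists mu, (forall s : 'I_D.+1, s = r.+1 :> nat ->
                As *m (A *m v) = ths s *: (A *m v)) /\
     forall s : 'I_D.+1, s = r.+2 :> nat ->
       As *m (A *m (A *m v)) = ths s *: (A *m (A *m v)) + ((ths r - ths s) * mu) *: v) &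
  (exists a b, As *m (A *m v) = a *: (A *m v) + b *: v) /\
  (exists a b, As *m (A *m (A *m v)) = a *: (A *m (A *m v)) + b *: v)].
Proof.
case: (ltngtP r D) => [rD|Dr|rD]; last first.
- have [a [v [vW v0 rv e]]] := Es_r_eigenvector W_A.
  have Av : A *m v = a *: v.
    rewrite [LHS](idem_sum Es_sum) (bigD1 r) //= mulmxA e big1 ?addr0 // => i ir.
    by rewrite W_lt_r ?W_A //; have := ltn_ord i; move: ir; rewrite -val_eqE /=; lia.
  have Asv : As *m v = ths r *: v by rewrite -rv mulmxA As_Es -scalemxAl.
  exists v; split => //.
    (* The indices r + 1 and r + 2 exceed D here, so [mu] is arbitrary. *)
    by exists 0; split=> s hs; have := ltn_ord s; lia.
  rewrite Av -!scalemxAr Av -!scalemxAr Asv.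
  by split; exists (ths r), 0; rewrite scale0r addr0 !scalerA; congr (_ *: _); ring.
- by have := ltn_ord r; lia.
have hAA : mxstable (A *m A) W by move=> v vW; rewrite -mulmxA; do 2!apply: W_A.
have [mu [v [vW v0 rv e]]] := Es_r_eigenvector hAA.
have Asv : As *m v = ths r *: v by rewrite -rv mulmxA As_Es -scalemxAl.
pose s1 : 'I_D.+1 := inord r.+1.
have s1E : s1 = r.+1 :> nat by rewrite inordK.
have Av : A *m v = Es s1 *m (A *m v).
  rewrite [LHS](idem_sum Es_sum) (bigD1 s1) //= big1 ?addr0 // => i; rewrite -val_eqE /= s1E => is1.
  have [ir|ri] := ltnP i r; first by rewrite W_lt_r ?W_A.
  by rewrite -rv !mulmxA Es_A_Es ?mul0mx // -val_eqE /=; lia.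
have AsAv : As *m (A *m v) = ths s1 *: (A *m v).
  by rewrite Av mulmxA As_Es -scalemxAl.
(* [s2] is the only index besides [r] at which A^2 v can have a component: r + 2, or r + 1 itself if
   r + 1 = D, where A may have a diagonal block. *)
pose s2 : 'I_D.+1 := if (s1 < D)%N then inord r.+2 else s1.
have s2E : (s1 < D)%N -> s2 = r.+2 :> nat.
  by move=> s1D; rewrite /s2 s1D inordK //; rewrite s1E in s1D.
have AAv : A *m (A *m v) = mu *: v + Es s2 *m (A *m (A *m v)).
  have rs2 : r != s2.
    rewrite -val_eqE /=; case: (ltnP s1 D) => [/s2E ->|Ds1]; first by lia.
    by rewrite /s2 ltnNge Ds1 /= s1E; lia.
  rewrite [LHS](idem_sum Es_sum) (bigD1 r) //= (bigD1 s2) 1?eq_sym //= big1 ?addr0.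
    by rewrite mulmxA [Es r *m A *m _]mulmxA -(mulmxA (Es r)) e.
  move=> i /andP [ir is2]; rewrite Av !mulmxA Es_A_Es ?mul0mx //.
  move: ir is2 (ltn_ord i); rewrite -!val_eqE /= s1E.
  by case: (ltnP s1 D) => [/[dup]/s2E -> |Ds1]; rewrite /s2 1?[(s1 < D)%N]ltnNge ?Ds1 /= ?s1E; lia.
have AsAAv : As *m (A *m (A *m v)) = ths s2 *: (A *m (A *m v)) + ((ths r - ths s2) * mu) *: v.
  rewrite {1}AAv mulmxDr -scalemxAr Asv mulmxA As_Es -scalemxAl.
  have -> : Es s2 *m (A *m (A *m v)) = A *m (A *m v) - mu *: v by rewrite {2}AAv addrC addKr.
  rewrite scalerBr !scalerA addrCA; congr (_ + _).
  by rewrite -scalerBl; congr (_ *: _); ring.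
exists v; split => //.
  exists mu; split=> s hs.
    by rewrite (_ : s = s1) //; apply: val_inj; rewrite /= s1E.
  rewrite (_ : s = s2) //; apply: val_inj; rewrite /= s2E //.
  by have := ltn_ord s; lia.
split; first by exists (ths s1), 0; rewrite scale0r addr0.
by exists (ths s2), ((ths r - ths s2) * mu).
Qed.

(** * The module generated by an endpoint vector *)

Section Generator.
Variable v : 'cV[F]_n.
Hypotheses (vW : v \in W) (v0 : v != 0) (rv : Es r *m v = v).
Hypothesis As_A_v : exists a b, As *m (A *m v) = a *: (A *m v) + b *: v.
Hypothesis As_AA_v :
  exists a b, As *m (A *m (A *m v)) = a *: (A *m (A *m v)) + b *: v.

Let E_Av k : E k *m (A *m v) = th k *: (E k *m v).
Proof. by rewrite mulmxA E_A -scalemxAl. Qed.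

(* For fixed k the vectors E_k A* E_l v vanish unless |k - l| <= 1; the three
   remaining ones are recovered, by Lagrange interpolation at the eigenvalues
   th l, from the combinations E_k A* A^j v (j <= 2), which are multiples of
   E_k v. *)
Lemma E_As_E_line k l : E k *m As *m E l *m v \in <[E k *m v]>%VS.
Proof.
have [far|] := boolP ((k.+1 < l)%N || (l.+1 < k)%N).
  by rewrite E_As_E // mul0mx mem0v.
rewrite negb_or -!leqNgt => /andP [lk kl].
have [a [b [al bl hab]]] := ord_two_others D_gt0 kl lk.
set L := <[_]>%VS.
have in0 : E k *m As *m v \in L.
  rewrite -rv -mulmxA (mulmxA As) As_Es -scalemxAl rv.
  by rewrite -scalemxAr memvZ ?memv_line.
have in1 : E k *m As *m (A *m v) \in L.
  have [a1 [b1 e]] := As_A_v; rewrite -mulmxA e mulmxDr -!scalemxAr E_Av.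
  by rewrite memvD ?memvZ ?memv_line.
have in2 : E k *m As *m (A *m (A *m v)) \in L.
  have [a1 [b1 e]] := As_AA_v; rewrite -mulmxA e mulmxDr -!scalemxAr.
  by rewrite (mulmxA (E k)) E_A -scalemxAl E_Av memvD ?memvZ ?memv_line.
(* [w] is (A - th a)(A - th b) v, without components at [a] and [b], so only m = l survives among
   the E_k A* E_m w. *)
pose w := A *m (A *m v) - (th a + th b) *: (A *m v) + (th a * th b) *: v.
have wL : E k *m As *m w \in L.
  by rewrite mulmxDr mulmxBr -!scalemxAr memvD ?memvB ?memvZ.
have Elw m : E m *m w = ((th m - th a) * (th m - th b)) *: (E m *m v).
  rewrite mulmxDr mulmxBr -!scalemxAr (mulmxA (E m)) E_A -scalemxAl !E_Av !scalerA.
  by rewrite -scalerBl -scalerDl; congr (_ *: _); ring.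
have c0 : (th l - th a) * (th l - th b) != 0.
  by rewrite mulf_neq0 // subr_eq0 (inj_eq th_inj) eq_sym.
rewrite -[_ *m v]scale1r -(mulVf c0) -scalerA memvZ //.
suff <- : E k *m As *m w = ((th l - th a) * (th l - th b)) *: (E k *m As *m E l *m v) by [].
rewrite {1}[w](idem_sum E_sum) mulmx_sumr (bigD1 l) //= big1 ?addr0.
  by rewrite Elw -!scalemxAr !mulmxA.
move=> m ml; have [far|] := boolP ((k.+1 < m)%N || (m.+1 < k)%N).
  by rewrite mulmxA E_As_E // mul0mx.
rewrite negb_or -!leqNgt => /andP [mk km].
have := hab m km mk; rewrite (negPf ml) Elw /= => /orP [] /eqP ->.
  by rewrite subrr mul0r scale0r mulmx0.
by rewrite subrr mulr0 scale0r mulmx0.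
Qed.

Lemma As_stable_sum_E_line w :
  (forall k l, E k *m As *m E l *m w \in <[E k *m w]>%VS) ->
  mxstable As (\sum_k <[E k *m w]>)%VS.
Proof.
move=> hw; apply: mxstable_sum_line => l.
rewrite (idem_sum E_sum (As *m _)); apply: memv_sumr => k _.
by rewrite !mulmxA hw.
Qed.

Lemma E_stable_sum_E_line w i : mxstable (E i) (\sum_k <[E k *m w]>)%VS.
Proof.
apply: mxstable_sum_line => l; rewrite (idem_mulv E_mul); case: eqP => _; last exact: mem0v.
exact: (mem_sum_line (fun k => E k *m w)).
Qed.

(** The sum of the lines E_k w is stable under the [E i] and [As], hence under the [Es i], which are
    polynomials in [As]. It contains [w], so irreducibility applies. *)
Lemma irreducible_eq w : w \in W -> w != 0 ->
  (forall k l, E k *m As *m E l *m w \in <[E k *m w]>%VS) ->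
  (\sum_k <[E k *m w]>)%VS = W.
Proof.
move=> wW w0 hw; have /W_irr := sum_idem_line_sub W_E wW.
case=> // [i|i|U0].
- exact: E_stable_sum_E_line.
- by apply: (mxstable_idem Es_mul Es_sum _ ths_inj); rewrite -As_def; apply: As_stable_sum_E_line.
case/eqP: w0; apply/eqP; rewrite -memv0 -U0 [X in X \in _](idem_sum E_sum).
by apply: memv_sumr => i _; rewrite memv_line.
Qed.

(** This is dual thinness, as W is the sum of the lines E_k v. *)
Lemma W_E_line k w : w \in W -> E k *m w \in <[E k *m v]>%VS.
Proof.
rewrite -(irreducible_eq vW v0 E_As_E_line) => /memv_sumP [u hu ->].
rewrite mulmx_sumr memv_suml // => i _.
have /vlineP [c ->] := hu i isT; rewrite -scalemxAr memvZ // (idem_mulv E_mul).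
by case: eqP => _; rewrite ?memv_line ?mem0v.
Qed.

(** Otherwise the components of [v] of index at most [k] would span a nonzero submodule, hence all
    of W, although it misses E_m v. *)
Lemma dual_raising_neq0 (t k k1 m : 'I_D.+1) :
  E t *m v != 0 -> (t <= k)%N -> k1 = k.+1 :> nat -> (k < m)%N -> E m *m v != 0 ->
  E k1 *m As *m E k *m v != 0.
Proof.
move=> t0 tk k1E km; apply: contra => /eqP e0.
pose w := \sum_(i < D.+1 | (i <= k)%N) E i *m v.
have Ew i : E i *m w = if (i <= k)%N then E i *m v else 0.
  rewrite mulmx_sumr; case: ifP => ik.
    rewrite (bigD1 i) //= (idem_mulv E_mul) eqxx big1 ?addr0 // => j /andP [_ ji].
    by rewrite (idem_mulv E_mul) eq_sym (negPf ji).
  by rewrite big1 // => j jk; rewrite (idem_mulv E_mul); case: eqP ik jk => // -> ->.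
have wW : w \in W by apply: memv_suml => i _; apply: W_E.
have w0 : w != 0 by apply: contra t0 => /eqP w0; have := Ew t; rewrite tk w0 mulmx0 => <-.
have hw i l : E i *m As *m E l *m w \in <[E i *m w]>%VS.
  rewrite -mulmxA !Ew; case: (leqP l k) => lk; last by rewrite mulmx0 mem0v.
  case: (leqP i k) => ik; first by rewrite mulmxA E_As_E_line.
  rewrite mulmxA; have [far|] := boolP ((i.+1 < l)%N || (l.+1 < i)%N).
    by rewrite E_As_E // mul0mx mem0v.
  (* The only way out of the truncated span is from [l = k] to [i = k + 1], which [e0] closes. *)
  move=> near; have -> : i = k1 by apply: val_inj => /=; lia.
  by have -> : l = k; [apply: val_inj => /=; lia | rewrite e0 mem0v].
have := vW; rewrite -(irreducible_eq wW w0 hw) => /memv_sumP [u hu ->].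
rewrite mulmx_sumr big1 // => i _; have /vlineP [c ->] := hu i isT.
rewrite -scalemxAr (idem_mulv E_mul) Ew leqNgt km.
by case: eqP => _; rewrite scaler0.
Qed.

(** By induction on [k], E_k v is obtained from A* E_{k-1} v by removing the components of smaller
    index and dividing by a nonzero scalar. So E_t v generates W under A*. *)
Lemma dual_generator (t m : 'I_D.+1) :
  E t *m v != 0 -> (forall i : 'I_D.+1, (i < t)%N -> E i *m v = 0) ->
  E m *m v != 0 -> (forall i : 'I_D.+1, (m < i)%N -> E i *m v = 0) ->
  W = (\sum_i <[Es i *m (E t *m v)]>)%VS.
Proof.
move=> t0 ltt m0 gtm; set u := E t *m v; set U := (\sum_i _)%VS.
apply: subv_anti; apply/andP; split; last first.
  by apply: (sum_idem_line_sub W_Es); apply: W_E.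
have UAs : mxstable As U.
  apply: mxstable_sum_line => i; rewrite mulmxA As_Es -scalemxAl memvZ //.
  exact: (mem_sum_line (fun i => Es i *m u)).
rewrite -(irreducible_eq vW v0 E_As_E_line); apply/subv_sumP => k _; rewrite -memvE.
have [j] := ubnP (nat_of_ord k); elim: j k => // j IH k; rewrite ltnS => kj.
have [kt|tk|kt] := ltngtP k t; first by rewrite ltt ?mem0v.
- have [mk|km] := ltnP m k; first by rewrite gtm ?mem0v.
  pose k' : 'I_D.+1 := inord k.-1.
  have k'E : k' = k.-1 :> nat by rewrite inordK //; have := ltn_ord k; lia.
  have nz : E k *m As *m E k' *m v != 0.
    by apply: (@dual_raising_neq0 t k' k m) => //; lia.
  have /vlineP [c ce] := E_As_E_line k k'.
  have c0 : c != 0 by apply: contra nz => /eqP c0; rewrite ce c0 scale0r.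
  rewrite -[_ *m v]scale1r -(mulVf c0) -scalerA -ce memvZ //.
  have hU : As *m (E k' *m v) \in U by apply: UAs; apply: IH; lia.
  rewrite (idem_sum E_sum (As *m _)) (bigD1 k) //= in hU.
  rewrite -mulmxA -mulmxA.
  (* The components other than the one at [k] that can be nonzero have index k - 2 or k - 1, so they
     lie in [U] by induction. *)
  rewrite -(addrK (\sum_(i | i != k) E i *m (As *m (E k' *m v))) (_ *m _)).
  rewrite memvB // memv_suml // => i; rewrite -val_eqE /= => ik.
  have [far|] := boolP ((i.+1 < k')%N || (k'.+1 < i)%N).
    by rewrite !mulmxA E_As_E // mul0mx mem0v.
  move=> near; have /vlineP [c' e] := E_As_E_line i k'.
  by rewrite !mulmxA e memvZ // IH //; lia.
have -> : k = t by apply: val_inj.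
rewrite -/u [u](idem_sum Es_sum) memv_suml // => i _.
exact: (mem_sum_line (fun i => Es i *m u)).
Qed.
End Generator.

(** * The matrix of A* on the module *)

Variable t : 'I_D.+1.
Hypothesis W_t : exists2 u, u \in W & E t *m u != 0.
Hypothesis W_lt_t : forall (i : 'I_D.+1) u, (i < t)%N -> u \in W -> E i *m u = 0.

(** [X] is the matrix of A* in the basis of nonzero E_k v. Its row sums weighted by 1, [th l],
    [th l ^+ 2] come from E_k A* applied to v, A v, A^2 v. The vector [u] is E_t v; the count of its
    components will give the diameter m - t. *)
Lemma tridiagonal_module_structure :
  exists v u (m : 'I_D.+1) (X : 'I_D.+1 -> 'I_D.+1 -> F) mu,
  [/\ [/\ v \in W, v != 0, Es r *m v = v &
         forall w, w \in W -> Es r *m w \in <[v]>%VS],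
      [/\ u \in W, forall i w, w \in W -> Es i *m w \in <[Es i *m u]>%VS &
         #|[set i | Es i *m u != 0]| = (m - t).+1],
      (t <= m)%N /\ (forall k, (E k *m v != 0) = (t <= k <= m)%N),
      (forall k l, E k *m As *m E l *m v = X k l *: (E k *m v)) /\
      (forall k l : 'I_D.+1, [|| (k.+1 < l)%N, (l.+1 < k)%N, E k *m v == 0
         | E l *m v == 0] -> X k l = 0) &
      forall k, E k *m v != 0 ->
      [/\ \sum_l X k l = ths r,
          forall s : 'I_D.+1, s = r.+1 :> nat ->
            \sum_l th l * X k l = ths s * th k &
          forall s : 'I_D.+1, s = r.+2 :> nat ->
            \sum_l th l ^+ 2 * X k l = ths s * th k ^+ 2 + (ths r - ths s) * mu]].
Proof.
have [v [vW v0 rv [mu [rel1 rel2]] [As1 As2]]] := endpoint_vector.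
have line := E_As_E_line rv As1 As2.
have Wline k w wW := W_E_line vW v0 rv As1 As2 k (w := w) wW.
have Etv : E t *m v != 0.
  have [w wW w0] := W_t; apply: contra w0 => /eqP v0'.
  by have := Wline t w wW; rewrite v0' => /vlineP [c ->]; rewrite scaler0.
have Elt (i : 'I_D.+1) : (i < t)%N -> E i *m v = 0 by move=> it; apply: W_lt_t.
pose m := [arg max_(i > t | E i *m v != 0) (i : nat)].
have [Emv Egt] : E m *m v != 0 /\ forall i : 'I_D.+1, (m < i)%N -> E i *m v = 0.
  rewrite /m; case: arg_maxnP => // i i0 hi; split=> // j ij.
  by apply/eqP/contraT => /hi /(leq_trans ij); rewrite ltnn.
have tm : (t <= m)%N by rewrite leqNgt; apply: contra Emv => /Elt ->; rewrite eqxx.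
have suppE k : (E k *m v != 0) = (t <= k <= m)%N.
  apply/idP/idP => [k0|/andP [tk km]].
    apply/andP; split; rewrite leqNgt; apply/negP => lt_k; move: k0.
      by rewrite (Elt _ lt_k) eqxx.
    by rewrite (Egt _ lt_k) eqxx.
  move: km; rewrite leq_eqVlt => /orP [/eqP /val_inj -> //|km].
  move: tk; rewrite leq_eqVlt => /orP [/eqP /val_inj <- //|tk].
  (* No gap can occur strictly between [t] and [m]: E_k A* E_{k-1} v is nonzero and a multiple of
     E_k v. *)
  pose k' : 'I_D.+1 := inord k.-1.
  have k'E : k' = k.-1 :> nat by rewrite inordK //; have := ltn_ord k; lia.
  have : E k *m As *m E k' *m v != 0.
    by apply: (dual_raising_neq0 vW v0 rv As1 As2 Etv (m := m)) => //; lia.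
  by have /vlineP [c ->] := line k k'; apply: contra => /eqP ->; rewrite scaler0.
have defW := dual_generator vW v0 rv As1 As2 Etv Elt Emv Egt.
set u := E t *m v in defW.
have uW : u \in W by apply: W_E.
have uline i w : w \in W -> Es i *m w \in <[Es i *m u]>%VS.
  rewrite defW => /memv_sumP [u' hu' ->]; rewrite mulmx_sumr memv_suml // => j _.
  have /vlineP [c ->] := hu' j isT; rewrite -scalemxAr memvZ // (idem_mulv Es_mul).
  by case: eqP => _; rewrite ?memv_line ?mem0v.
(* If E_k v = 0 the scalar is undetermined; it is set to 0, so that [X] vanishes off the support of
   [v]. *)
have : forall kl : 'I_D.+1 * 'I_D.+1, exists c,
    E kl.1 *m As *m E kl.2 *m v = c *: (E kl.1 *m v) /\
    ([|| (kl.1.+1 < kl.2)%N, (kl.2.+1 < kl.1)%N, E kl.1 *m v == 0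
         | E kl.2 *m v == 0] -> c = 0).
  move=> [k l] /=; case: (boolP [|| _, _, _ | _]) => [/or4P [far|far|/eqP k0|/eqP l0]|_].
  - by exists 0; rewrite (@E_As_E k l) ?mul0mx ?scale0r // far.
  - by exists 0; rewrite (@E_As_E k l) ?mul0mx ?scale0r // far orbT.
  - have /vlineP [c ->] := line k l; exists 0.
    by rewrite k0 !scaler0.
  - by exists 0; rewrite -mulmxA l0 mulmx0 scale0r.
  by have /vlineP [c e] := line k l; exists c.
case/fin_all_exists => X hX.
(* Compares coefficients of E_k v in E_k A* w; used for w = v, A v, A^2 v. *)
have relX k (c : 'I_D.+1 -> F) w a : E k *m v != 0 ->
    (forall l, E l *m w = c l *: (E l *m v)) -> E k *m (As *m w) = a *: (E k *m v) ->
    \sum_l c l * X (k, l) = a.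
  move=> k0 hc ha; apply/eqP; rewrite -subr_eq0.
  have /eqP : (\sum_l c l * X (k, l) - a) *: (E k *m v) = 0.
    rewrite scalerBl -ha mulmxA {1}[w](idem_sum E_sum) mulmx_sumr scaler_suml -sumrB big1 // => l _.
    by rewrite hc -scalemxAr -scalerA -(hX (k, l)).1 /= -!mulmxA subrr.
  by rewrite scaler_eq0 (negPf k0) orbF.
have EA k w : E k *m (A *m w) = th k *: (E k *m w) by rewrite mulmxA E_A -scalemxAl.
have Asv : As *m v = ths r *: v by rewrite -rv mulmxA As_Es -scalemxAl.
exists v, u, m, (fun k l => X (k, l)), mu; split.
- split=> // w wW; have /vlineP [c e] := uline r _ vW.
  have c0 : c != 0 by apply: contra v0 => /eqP c0; rewrite -rv e c0 scale0r.
  have /vlineP [c' ->] := uline r _ wW.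
  by rewrite memvZ // -[_ *m u]scale1r -(mulVf c0) -scalerA -e rv memvZ ?memv_line.
(* The dimension of W is counted once through the E*_i u and once through the E_k v. *)
- split=> //; rewrite -(dim_sum_idem_line Es_mul) -defW.
  rewrite -(irreducible_eq vW v0 line) (dim_sum_idem_line E_mul).
  have -> : [set i | E i *m v != 0] = [set i : 'I_D.+1 | (t <= i < m.+1)%N].
    by apply/setP => i; rewrite !inE suppE ltnS.
  rewrite -sum1dep_card -(big_ord_widen_cond _ (fun i => t <= i)%N (fun=> 1%N)) ?ltn_ord //.
  by rewrite -(big_geq_mkord t m.+1 predT (fun=> 1%N)) sum_nat_const_nat muln1; lia.
- by split.
- split=> k l; first exact: (hX (k, l)).1.
  exact: (hX (k, l)).2.
move=> k k0; split.
- rewrite -(@relX k (fun=> 1) v (ths r) k0).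
  + by apply: eq_bigr => l _; rewrite mul1r.
  + by move=> l; rewrite scale1r.
  + by rewrite Asv -scalemxAr.
- move=> s hs; apply: (@relX k _ (A *m v)) => //.
  by rewrite (rel1 s hs) -scalemxAr EA scalerA.
move=> s hs; apply: (@relX k _ (A *m (A *m v))) => // [l|].
  by rewrite !EA scalerA.
by rewrite (rel2 s hs) mulmxDr -!scalemxAr !EA !scalerA -scalerDl.
Qed.
End TridiagonalModule.

Lemma span_codomP (F : fieldType) (V : vectType F) (I : finType) (f : I -> V) (v : V) :
  v \in <<codom f>>%VS <-> exists c : I -> F, v = \sum_i c i *: f i.
Proof.
split=> [|[c ->]]; last first.
  by rewrite memv_suml // => i _; rewrite memvZ // memv_span ?codom_f.
rewrite span_def big_image => /memv_sumP [u hu ->].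
have /fin_all_exists [c hc] : forall i, exists c, u i = c *: f i.
  by move=> i; apply/vlineP/hu.
by exists c; apply: eq_bigr.
Qed.

(** * The Bose-Mesner algebra and its dual *)

Section AssociationScheme.
Variables (C : numClosedFieldType) (X : finType) (D : nat).
Variable Y : assoc_scheme X D.
Local Notation M := (bose_mesner C Y).
Local Notation assoc := (assoc_mx C Y).
Implicit Types (x y z : X) (h i j k l : 'I_D.+1).

Lemma srel_uniq i j x y : (x, y) \in srel Y i -> (x, y) \in srel Y j -> i = j.
Proof. by have [k [_ hk]] := srel_part Y x y => /hk <- /hk. Qed.

(** The valency [pnum Y ord0 i i] is positive because R_i is nonempty, and it is the same at every
    point. *)
Lemma srel_exists i x : exists y, (x, y) \in srel Y i.
Proof.
have /set0Pn [[y z] yz] := srel_neq0 Y i.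
have yy : (y, y) \in srel Y ord0 by rewrite srel_diag.
have xx : (x, x) \in srel Y ord0 by rewrite srel_diag.
have : (0 < pnum Y ord0 i i)%N.
  rewrite -(pnumP i i yy); apply/card_gt0P; exists z.
  by rewrite inE yz srel_sym.
rewrite -(pnumP i i xx) => /card_gt0P [w]; rewrite inE => /andP [xw _].
by exists w.
Qed.

Lemma assoc_mxE i y z : assoc i (enum_rank y) (enum_rank z) = ((y, z) \in srel Y i)%:R.
Proof. by rewrite mxE !enum_rankK. Qed.

Lemma tr_assoc_mx i : (assoc i)^T = assoc i.
Proof. by apply/matrixP => y z; rewrite !mxE srel_sym. Qed.

Lemma conj_assoc_mx i : map_mx Num.conj (assoc i) = assoc i.
Proof. by apply/matrixP => y z; rewrite !mxE rmorph_nat. Qed.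

Lemma bose_mesner_tr B : B \in M -> B^T = B.
Proof.
move=> /span_codomP [c ->]; rewrite linear_sum; apply: eq_bigr => i _ /=.
by rewrite linearZ /= tr_assoc_mx.
Qed.

Lemma bose_mesner_conj B : B \in M -> map_mx Num.conj B \in M.
Proof.
move=> /span_codomP [c ->]; apply/span_codomP; exists (fun i => (c i)^*).
rewrite map_mx_sum; apply: eq_bigr => i _.
by rewrite map_mxZ conj_assoc_mx.
Qed.

Lemma assoc_mx0 : assoc ord0 = 1%:M.
Proof. by apply/matrixP => y z; rewrite !mxE srel_diag (inj_eq enum_val_inj). Qed.

Lemma assoc_mx_mul i j : assoc i *m assoc j = \sum_h (pnum Y h i j)%:R *: assoc h.
Proof.
apply/matrixP => y z; rewrite !mxE summxE.
have [h [yz _]] := srel_part Y (enum_val y) (enum_val z).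
rewrite [RHS](bigD1 h) //= [X in _ + X]big1 ?addr0.
  rewrite !mxE yz mulr1 -(pnumP i j yz) -[in RHS]sum1_card natr_sum [RHS]big_mkcond /=.
  rewrite [RHS](reindex (@enum_val X predT)) /=; last first.
    by exists enum_rank => w _; rewrite ?enum_valK ?enum_rankK.
  by apply: eq_bigr => w _; rewrite !mxE inE -natrM mulnb; case: (_ && _).
move=> k kh; rewrite !mxE; case: (boolP (_ \in _)) => [yz'|_]; last by rewrite mulr0.
by rewrite (srel_uniq yz yz') eqxx in kh.
Qed.

(** * Primitive idempotents and their reality *)

Section Idempotents.
Variable E : 'I_D.+1 -> 'M[C]_#|X|.
Hypothesis hE : primitive_idempotents Y E.

Let E_mul i j : E i *m E j = if i == j then E i else 0. Proof. by case: hE. Qed.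
Let E_sum : \sum_i E i = 1%:M. Proof. by case: hE. Qed.

Lemma bose_mesnerP B : B \in M <-> exists c : 'I_D.+1 -> C, B = \sum_i c i *: E i.
Proof. by case: hE => /andP [/eqP <- _] _ _ _; apply: span_codomP. Qed.

Lemma idem_mem i : E i \in M.
Proof. by case: hE => /andP [/eqP <- _] _ _ _; rewrite memv_span ?codom_f. Qed.

Lemma idem_neq0 i : E i != 0.
Proof.
have [/andP [_ hfree] _ _ _] := hE.
exact: free_not0 hfree (codom_f E i).
Qed.

Lemma bose_mesner_comm B B' : B \in M -> B' \in M -> B *m B' = B' *m B.
Proof.
move=> /bose_mesnerP [c ->] /bose_mesnerP [c' ->].
rewrite !mulmx_suml; apply: eq_bigr => i _; rewrite !mulmx_sumr (bigD1 i) //=.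
rewrite [RHS](bigD1 i) //=.
rewrite -!scalemxAl -!scalemxAr E_mul eqxx !scalerA mulrC; congr (_ + _).
by rewrite !big1 // => j ij;
  rewrite -scalemxAl -scalemxAr E_mul ?[i == j]eq_sym (negPf ij) !scaler0.
Qed.

(* The conjugate P of E_i lies in M and P *m E_i is a multiple c E_i with
   c ^+ 2 = c; c != 0 since the trace of P *m E_i is the Hilbert-Schmidt norm
   of E_i. *)
Lemma conj_idem i : map_mx Num.conj (E i) = E i.
Proof.
set P := map_mx _ _.
have PM : P \in M by apply/bose_mesner_conj/idem_mem.
have PP : P *m P = P by rewrite -map_mxM E_mul eqxx.
have [c PE] : exists c, P *m E i = c *: E i.
  have /bose_mesnerP [c ->] := PM; exists (c i).
  by rewrite (mulmx_lincomb E_mul i (erefl _)).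
have c0 : c != 0.
  apply/eqP => c0; rewrite c0 scale0r in PE; case/eqP: (idem_neq0 i).
  apply/matrixP => y z; rewrite mxE.
  have /matrixP /(_ z z) := PE; rewrite !mxE => /psumr_eq0P h.
  (* As [E i] is symmetric, the diagonal entries of [P *m E i] are sums of squared moduli. *)
  have /h /(_ y isT) : forall w : 'I_#|X|, true -> 0 <= P z w * E i w z.
    move=> w _; rewrite -(bose_mesner_tr (idem_mem i)) !mxE mulrC.
    exact: mul_conjC_ge0.
  rewrite -(bose_mesner_tr (idem_mem i)) !mxE => /eqP.
  rewrite mulrC mul_conjC_eq0 => /eqP e.
  exact: e.
have c1 : c = 1.
  have : c *: E i == 1 *: E i.
    have : P *m (P *m E i) = c *: E i by rewrite mulmxA PP.
    rewrite PE -scalemxAr PE => /(congr1 (GRing.scale c^-1)).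
    by rewrite !scalerA mulVf // mul1r => ->; rewrite scale1r.
  by rewrite -subr_eq0 -scalerBl scaler_eq0 (negPf (idem_neq0 i)) orbF subr_eq0 => /eqP.
rewrite c1 scale1r in PE; rewrite -[RHS]PE.
(* Conjugating P E_i = E_i gives E_i P = P, and the two factors commute. *)
have := congr1 (map_mx Num.conj) PE; rewrite map_mxM -/P.
have -> : map_mx Num.conj P = E i by apply/matrixP => y z; rewrite !mxE conjCK.
by rewrite (bose_mesner_comm PM (idem_mem i)).
Qed.

Lemma idem_real i (y z : 'I_#|X|) : E i y z \is Num.real.
Proof. by apply/CrealP; rewrite -[in RHS]conj_idem mxE. Qed.

(** * Eigenvalues of A *)

Section Eigenvalues.
Variable theta : 'I_D.+1 -> C.
Hypothesis htheta : forall i, adj_mx C Y *m E i = theta i *: E i.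
Hypothesis D_gt0 : (0 < D)%N.

Lemma zext_ord (V : nmodType) (f : 'I_D.+1 -> V) i : zext f (i : nat)%:Z = f i.
Proof. by rewrite /zext insubT ?ltn_ord // => lt; congr f; apply: val_inj. Qed.

Lemma adj_mxE : adj_mx C Y = assoc (inord 1).
Proof. by rewrite /adj_mx -zext_ord inordK. Qed.

Lemma theta_real i : theta i \is Num.real.
Proof.
apply/CrealP; apply/eqP; rewrite -subr_eq0.
have : ((theta i)^* - theta i) *: E i == 0.
  rewrite scalerBl subr_eq0 -htheta adj_mxE -{1}conj_idem -map_mxZ -htheta adj_mxE.
  by rewrite map_mxM conj_idem conj_assoc_mx.
by rewrite scaler_eq0 (negPf (idem_neq0 i)) orbF.
Qed.

(* A generates M because A A_h involves A_(h+1) with a nonzero coefficient;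
   hence an element of M taking equal values on E_i and E_j for A does so
   throughout M. *)
Lemma theta_inj : P_polynomial Y -> injective theta.
Proof.
move=> hP i j eq_th.
pose K (B : 'M[C]_#|X|) := exists c, B *m E i = c *: E i /\ B *m E j = c *: E j.
have KZ a B : K B -> K (a *: B).
  by move=> [c [e e']]; exists (a * c); rewrite -!scalemxAl e e' !scalerA.
have KD B B' : K B -> K B' -> K (B + B').
  move=> [c [e1 e2]] [c' [e1' e2']]; exists (c + c').
  by rewrite !mulmxDl e1 e2 e1' e2' !scalerDl.
have Ksum (I : finType) (p : pred I) (B : I -> 'M_#|X|) :
    (forall b : I, p b -> K (B b)) -> K (\sum_(b | p b) B b).
  by move=> hB; apply: big_ind => //; exists 0; rewrite !mul0mx !scale0r.
have Kassoc h : K (assoc h).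
  have [n] := ubnP (nat_of_ord h); elim: n h => // n IH h; rewrite ltnS => hn.
  have [h0|h0] := posnP h.
    by exists 1; rewrite (_ : h = ord0) ?assoc_mx0 ?mul1mx ?scale1r //; apply: val_inj.
  pose g : 'I_D.+1 := inord h.-1; pose one : 'I_D.+1 := inord 1.
  have gE : g = h.-1 :> nat by rewrite inordK //; have := ltn_ord h; lia.
  have oneE : one = 1%N :> nat by rewrite inordK.
  have p0 : (pnum Y h one g)%:R != 0 :> C.
    by rewrite pnatr_eq0; apply/eqP; apply: (hP h one g).2; rewrite -?val_eqE /=; lia.
  have Kg : K (assoc one *m assoc g).
    have [|c [e1 e2]] := IH g; first by lia.
    exists (theta i * c); rewrite -!mulmxA e1 e2 -!scalemxAr -adj_mxE !htheta eq_th.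
    by rewrite !scalerA mulrC.
  rewrite assoc_mx_mul (bigD1 h) //= in Kg.
  rewrite -[assoc h]scale1r -(mulVf p0) -scalerA; apply: (KZ _ _).
  (* The term for [h] is isolated: every other index falls under the induction hypothesis or exceeds
     [h], where the coefficient is 0. *)
  rewrite -[_ *: _](addrK (\sum_(k | k != h) (pnum Y k one g)%:R *: assoc k)) -scaleN1r.
  apply: KD => //; apply: (KZ _ _); apply: Ksum => k; rewrite -val_eqE /= => kh.
  have [kn|nk] := ltnP k n; first by apply/KZ/IH.
  rewrite (hP k one g).1; last by rewrite oneE; lia.
  by exists 0; rewrite !scale0r !mul0mx.
(* [E i] acts as 1 on itself but as 0 on [E j] if [j != i]. *)
have [c [e1 e2]] : K (E i).
  have /span_codomP [c ->] := idem_mem i; apply: Ksum => k _; exact: KZ.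
rewrite !E_mul eqxx in e1 e2.
have c1 : c != 0 by apply: contraNneq (idem_neq0 i) => c0; rewrite e1 c0 scale0r.
case: eqP e2 => // _ /esym/eqP.
by rewrite scaler_eq0 (negPf c1) (negPf (idem_neq0 j)).
Qed.
End Eigenvalues.

(** * Dual eigenvalues and vanishing triple products *)

Section DualEigenvalues.
Variables (q : 'I_D.+1 -> 'I_D.+1 -> 'I_D.+1 -> C) (thetas : 'I_D.+1 -> C) (x : X).
Hypothesis D_gt0 : (0 < D)%N.
Hypothesis hq : krein_parameters E q.
Hypothesis hQ : polynomial_numbers q.
Hypothesis hthetas : forall i,
  dual_adj_mx x E *m dual_idem C Y x i = thetas i *: dual_idem C Y x i.
Local Notation As := (dual_adj_mx x E).
Local Notation Es := (dual_idem C Y x).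
Local Notation one := (inord 1 : 'I_D.+1).

Let oneE : one = 1%N :> nat. Proof. by rewrite inordK. Qed.

Lemma dual_adj_mxE :
  As = diag_mx (\row_y (#|X|%:R * E one (enum_rank x) y)).
Proof. by rewrite /dual_adj_mx -zext_ord oneE. Qed.

Lemma cardX_neq0 : #|X|%:R != 0 :> C.
Proof. by rewrite pnatr_eq0 -lt0n; apply/card_gt0P; exists x. Qed.

Lemma dual_idem_mul i j : Es i *m Es j = if i == j then Es i else 0.
Proof.
rewrite /dual_idem mulmx_diag; apply/matrixP => y z.
case: eqP => [<-|ij]; rewrite !mxE; first by rewrite -natrM mulnb andbb.
rewrite -natrM mulnb; case: andP => [[yi yj]|_]; last by rewrite mul0rn.
by case: ij; apply: srel_uniq yi yj.
Qed.

Lemma dual_idem_sum : \sum_i Es i = 1%:M.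
Proof.
apply/matrixP => y z; rewrite summxE !mxE.
have [h [xy _]] := srel_part Y x (enum_val y).
rewrite (bigD1 h) //= [X in _ + X]big1 ?addr0 ?mxE ?xy // => k kh.
rewrite !mxE; case: (boolP (_ \in _)) => [xy'|_]; last by rewrite mul0rn.
by rewrite (srel_uniq xy xy') eqxx in kh.
Qed.

Lemma thetasE i y : (x, y) \in srel Y i ->
  thetas i = #|X|%:R * E one (enum_rank x) (enum_rank y).
Proof.
move=> xy; have /matrixP /(_ (enum_rank y) (enum_rank y)) := hthetas i.
rewrite dual_adj_mxE mul_diag_mx !mxE enum_rankK eqxx xy.
by rewrite !mulr1n !mulr1.
Qed.

Lemma thetas_real i : thetas i \is Num.real.
Proof.
have [y /thetasE ->] := srel_exists i x.
by rewrite realM ?realn ?idem_real.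
Qed.

(* Dually, E_1 generates M under the entrywise product. *)
Lemma thetas_inj : injective thetas.
Proof.
move=> i j eq_th.
have [y xy] := srel_exists i x; have [z xz] := srel_exists j x.
(* [f] vanishes on E_1, and by the Krein recurrence on every E_h, hence on A_i; this puts [(x, z)]
   in R_i as well as in R_j. *)
pose f (B : 'M[C]_#|X|) := B (enum_rank x) (enum_rank y) - B (enum_rank x) (enum_rank z).
have f1 : E one (enum_rank x) (enum_rank y) = E one (enum_rank x) (enum_rank z).
  by apply: (mulfI cardX_neq0); rewrite -(thetasE xy) -(thetasE xz).
have f_lincomb (p : pred 'I_D.+1) c (B : 'I_D.+1 -> 'M_#|X|) :
    f (\sum_(k | p k) c k *: B k) = \sum_(k | p k) c k * f (B k).
  rewrite /f !summxE -sumrB; apply: eq_bigr => k _; rewrite !mxE; ring.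
have fE h : f (E h) = 0.
  have [n] := ubnP (nat_of_ord h); elim: n h => // n IH h; rewrite ltnS => hn.
  have [h0|h0] := posnP h.
    rewrite (_ : h = ord0); last exact: val_inj.
    by have [_ _ _ ->] := hE; rewrite /f !mxE subrr.
  pose g : 'I_D.+1 := inord h.-1.
  have gE : g = h.-1 :> nat by rewrite inordK //; have := ltn_ord h; lia.
  have q0 : q h one g != 0.
    by apply/eqP; apply: (hQ h one g).2; rewrite -?val_eqE /=; lia.
  have fg : f (map2_mx *%R (E one) (E g)) = 0.
    rewrite /f !mxE -f1 -mulrBr -/(f (E g)) IH ?mulr0 //; lia.
  apply/eqP; move/eqP: fg; rewrite hq /f !mxE -mulrBr mulf_eq0 invr_eq0.
  rewrite (negPf cardX_neq0) /= -/(f _) f_lincomb (bigD1 h) //= big1 ?addr0.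
    by rewrite mulf_eq0 (negPf q0).
  move=> k; rewrite -val_eqE /= => kh.
  have [kn|nk] := ltnP k n; first by rewrite IH ?mulr0.
  by rewrite (hQ k one g).1 ?mul0r // oneE; lia.
have : f (assoc i) = 0.
  have /bose_mesnerP [c ->] : assoc i \in M by apply/memv_span/codom_f.
  by rewrite f_lincomb big1 // => k _; rewrite fE mulr0.
move/eqP; rewrite /f !assoc_mxE xy subr_eq0.
by case: (boolP (_ \in _)) => [/(srel_uniq xz) -> //|_]; rewrite oner_eq0.
Qed.

(* tr (B *m B^T) for the real matrix B = E_k A* E_l is a multiple of the
   Krein parameter q^1_{kl}. *)
Lemma triple_product_eq0 k l : q one k l = 0 -> E k *m As *m E l = 0.
Proof.
move=> q0; set B := _ *m _; set a := \row_y (#|X|%:R * E one (enum_rank x) y).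
have Breal (y z : 'I_#|X|) : B y z \is Num.real.
  rewrite /B dual_adj_mxE mul_mx_diag mxE rpred_sum // => w _.
  by rewrite !mxE !realM ?idem_real ?realn.
have trB : B^T = E l *m As *m E k.
  by rewrite /B !trmx_mul !(bose_mesner_tr (idem_mem _)) dual_adj_mxE tr_diag_mx mulmxA.
have trace0 : \tr (B *m B^T) = 0.
  rewrite trB /B !mulmxA mxtrace_mulC !mulmxA E_mul eqxx.
  rewrite -(mulmxA (E k *m As)) E_mul eqxx.
  (* The trace is the quadratic form of the entrywise product of E_k and E_l at [a], a multiple of a
     row of E_1. So only h = 1 can contribute to the Krein expansion, with coefficient q^1_{kl} =
     0. *)
  have -> : \tr (E k *m As *m E l *m As) = (a *m map2_mx *%R (E k) (E l) *m a^T) 0 0.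
    rewrite dual_adj_mxE !mul_mx_diag -/a !mxE.
    rewrite [RHS](eq_bigr (fun w => \sum_u a 0 u * (E k u w * E l u w) * a 0 w)).
      rewrite exchange_big /mxtrace; apply: eq_bigr => u _; rewrite !mxE mulr_suml.
      apply: eq_bigr => w _; rewrite !mxE.
      rewrite -[in E l w u](bose_mesner_tr (idem_mem l)) [(E l)^T _ _]mxE.
      by ring.
    by move=> w _; rewrite !mxE mulr_suml; apply: eq_bigr => u _; rewrite !mxE.
  rewrite hq -scalemxAr -scalemxAl mxE mulmx_sumr mulmx_suml summxE big1 ?mulr0 // => h _.
  rewrite -scalemxAr -scalemxAl mxE.
  have [->|h1] := eqVneq h one; first by rewrite q0 mul0r.
  have -> : a = #|X|%:R *: row (enum_rank x) (E one).
    by apply/matrixP => y z; rewrite !mxE.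
  rewrite -!scalemxAl -row_mul E_mul eq_sym (negPf h1).
  by rewrite row0 mul0mx scaler0 mxE mulr0.
apply/matrixP => y z; rewrite [RHS]mxE.
(* [B] is real, so its trace form is a sum of squares of its entries. *)
have sq0 (u w : 'I_#|X|) : 0 <= B u w * B u w.
  by rewrite -expr2 real_exprn_even_ge0 ?Breal.
have /psumr_eq0P h : \tr (B *m B^T) = 0 := trace0.
have /h /(_ y isT) : forall u, true -> 0 <= (B *m B^T) u u.
  by move=> u _; rewrite mxE sumr_ge0 // => w _; rewrite [B^T _ _]mxE.
rewrite mxE => /psumr_eq0P h'.
have /h' /(_ z isT) : forall w, true -> 0 <= B y w * B^T w y.
  by move=> w _; rewrite [B^T _ _]mxE.
by rewrite [B^T _ _]mxE => /eqP; rewrite mulf_eq0 orbb => /eqP.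
Qed.

Lemma idem_dual_adj_idem_eq0 k l :
  (k.+1 < l)%N || (l.+1 < k)%N -> E k *m As *m E l = 0.
Proof. by move=> far; apply/triple_product_eq0/(hQ one k l).1; rewrite oneE; lia. Qed.

Lemma dual_idem_adj_dual_idem_eq0 i j :
  P_polynomial Y -> almost_bipartite Y ->
  [|| (i.+1 < j)%N, (j.+1 < i)%N | (i == j) && (i < D)%N] ->
  Es i *m adj_mx C Y *m Es j = 0.
Proof.
move=> hP [hAB _] hij.
have p0 : pnum Y i one j = 0%N.
  have [far|] := boolP ((i.+1 < j)%N || (j.+1 < i)%N).
    by apply: (hP i one j).1; rewrite oneE; lia.
  by case/or3P: hij => [-> //|->|/andP [/eqP <- /hAB]]; rewrite ?orbT.
rewrite mul_mx_diag mul_diag_mx (adj_mxE D_gt0); apply/matrixP => u w; rewrite !mxE.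
case: (boolP (_ \in srel Y i)) => [xu|_]; last by rewrite !mul0r.
case: (boolP (_ \in srel Y one)) => [uw|_]; last by rewrite mulr0 mul0r.
case: (boolP (_ \in srel Y j)) => [xw|_]; last by rewrite mulr0.
move/eqP: p0; rewrite -(pnumP _ _ (etrans (srel_sym Y i _ _) xu)) cards_eq0.
by move=> /eqP /setP /(_ (enum_val w)); rewrite !inE uw srel_sym xw.
Qed.

Lemma adj_mx_sum (theta : 'I_D.+1 -> C) :
  (forall i, adj_mx C Y *m E i = theta i *: E i) -> adj_mx C Y = \sum_i theta i *: E i.
Proof.
by move=> htheta; rewrite -[LHS]mulmx1 -E_sum mulmx_sumr; apply: eq_bigr => i _.
Qed.

Lemma dual_adj_mx_sum : As = \sum_i thetas i *: Es i.
Proof. by rewrite -[LHS]mulmx1 -dual_idem_sum mulmx_sumr; apply: eq_bigr => i _. Qed.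

Lemma T_module_stable (W : {vspace 'cV[C]_#|X|}) : T_module Y x W <->
  (forall i, mxstable (E i) W) /\ (forall i, mxstable (Es i) W).
Proof.
split=> [hW|[WE WEs] B].
  split=> i v vW; apply: hW => //; last exact: terwilliger_dual.
  exact/terwilliger_BM/idem_mem.
elim=> [{}B /bose_mesnerP [c ->]|i|B1 B2 _ h1 _ h2|a {}B _ h|B1 B2 _ h1 _ h2] v vW.
- exact: mxstable_lincomb.
- exact: WEs.
- by rewrite mulmxDl memvD ?h1 ?h2.
- by rewrite -scalemxAl memvZ ?h.
- by rewrite -mulmxA h1 ?h2.
Qed.
End DualEigenvalues.

(** * Endpoints and integer indices *)

Lemma mx_img_neq0P (B : 'M[C]_#|X|) (W : {vspace 'cV[C]_#|X|}) :
  reflect (exists2 u, u \in W & B *m u != 0) (mx_img B W != 0%VS).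
Proof.
apply: (iffP idP) => [|[u uW u0]].
  rewrite -subv0 => /subvPn [v /memv_imgP [u uW ->]]; rewrite memv0 lfunE /=.
  by exists u.
apply: contra u0 => /eqP img0; rewrite -memv0 -img0.
by apply/memv_imgP; exists u; rewrite ?lfunE.
Qed.

Lemma find_enum_ord (p : pred 'I_D.+1) : (exists i, p i) ->
  exists r : 'I_D.+1, [/\ find p (enum 'I_D.+1) = r, p r & forall i, (i < r)%N -> ~~ p i].
Proof.
move=> [i pi]; have hp : has p (enum 'I_D.+1) by apply/hasP; exists i; rewrite ?mem_enum.
have lt : (find p (enum 'I_D.+1) < D.+1)%N by move: hp; rewrite has_find size_enum_ord.
exists (Ordinal lt); split=> //.
  have := nth_find ord0 hp; congr (is_true (p _)); apply: val_inj.
  by rewrite /= nth_enum_ord.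
move=> j /(before_find ord0) /negbT; rewrite (_ : nth _ _ _ = j) //.
by apply: val_inj; rewrite /= nth_enum_ord.
Qed.

Lemma zextP (k : int) : (exists i : 'I_D.+1, k = (i : nat)%:Z) \/
  forall (V : nmodType) (f : 'I_D.+1 -> V), zext f k = 0.
Proof.
case: k => [n|n]; last by right.
have [lt|ge] := ltnP n D.+1; first by left; exists (Ordinal lt).
by right=> V f; rewrite /zext insubF // ltnNge ge.
Qed.

Lemma zext_sum (V : nmodType) (f : 'I_D.+1 -> V) (k : int) :
  zext f k = \sum_(i < D.+1) if i%:Z == k then f i else 0.
Proof.
have [[i ->]|k0] := zextP k.
  rewrite zext_ord (bigD1 i) //= eqxx big1 ?addr0 // => j /negPf ji.
  by rewrite eqz_nat val_eqE ji.
(* The constant family 1 refutes [e]: its extension at [k] would be both 0 and 1. *)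
rewrite k0 big1 // => i _; case: eqP => // e; have := k0 _ (fun=> 1%N); rewrite -e zext_ord.
by [].
Qed.

(** Extension by zero keeps the three-term form valid at the ends, where a neighbour is missing. *)
Lemma sum_tridiagonal (g : 'I_D.+1 -> C) k :
  (forall l, (k.+1 < l)%N || (l.+1 < k)%N -> g l = 0) ->
  \sum_l g l = zext g (k%:Z - 1) + g k + zext g (k%:Z + 1).
Proof.
move=> far; rewrite -[g k]zext_ord !zext_sum -!big_split /=; apply: eq_bigr => l _.
case: (boolP ((k.+1 < l)%N || (l.+1 < k)%N)) => [/far ->|near].
  by rewrite !if_same !addr0.
case: eqP => e1; case: eqP => e2; case: eqP => e3; rewrite ?addr0 ?add0r //; lia.
Qed.

(** * Dual intersection numbers as matrix entries *)

Section DualScalars.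
Variables (x : X) (W : {vspace 'cV[C]_#|X|}) (r : 'I_D.+1) (v : 'cV[C]_#|X|).
Local Notation As := (dual_adj_mx x E).
Local Notation Es := (dual_idem C Y x).
Hypothesis hr : endpoint Y x W = r.
Hypotheses (vW : v \in W) (v0 : v != 0) (rv : Es r *m v = v).
Hypothesis rline : forall w, w \in W -> Es r *m w \in <[v]>%VS.

(** E*_r W is the line of [v], so the identity at [v] extends to all its vectors; E_l v being
    nonzero makes the scalar unique, and [xget] returns it. *)
Lemma dual_scalarE (B : 'M[C]_#|X|) (k l : int) (a : C) :
  zext E l *m v != 0 -> B *m (zext E k *m v) = a *: (zext E l *m v) ->
  dual_scalar Y x E W B k l = a.
Proof.
move=> l0 e; apply: classical_sets.xget_unique => [w|b]; rewrite hr zext_ord.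
  case/memv_imgP => u uW ->; rewrite lfunE /= => _.
  have /vlineP [c ->] := rline uW; rewrite -!scalemxAr e !scalerA mulrC.
  by [].
move=> /(_ v); rewrite v0; have vimg : v \in mx_img (Es r) W.
  by apply/memv_imgP; exists v; rewrite ?lfunE.
move=> /(_ vimg isT); rewrite e => /eqP; rewrite -subr_eq0 -scalerBl scaler_eq0.
by rewrite (negPf l0) orbF subr_eq0 eq_sym => /eqP.
Qed.

(** Treats R*, F* and L* together, [s] being the shift by 1, 0 or -1. Only the summand of index [k]
    survives on E_k v. *)
Lemma dual_sum_idem (s : int -> int) (k : int) :
  (\sum_(i < D.+1) zext E (s i%:Z) *m As *m E i) *m (zext E k *m v) =
  zext E (s k) *m As *m (zext E k *m v).
Proof.
have [[i ->]|k0] := zextP k; last by rewrite k0 mul0mx !mulmx0.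
rewrite zext_ord mulmx_suml (bigD1 i) //= -(mulmxA _ (E i)) (idem_mulv E_mul) eqxx.
rewrite big1 ?addr0 // => j /negPf ji.
by rewrite -(mulmxA _ (E j)) (idem_mulv E_mul) ji mulmx0.
Qed.

Variables (k : 'I_D.+1) (Xk : 'I_D.+1 -> C).
Hypothesis k0 : E k *m v != 0.
Hypothesis hX : forall l, E k *m As *m E l *m v = Xk l *: (E k *m v).

Let zX (l : int) : E k *m As *m (zext E l *m v) = zext Xk l *: (E k *m v).
Proof.
have [[i ->]|l0] := zextP l; first by rewrite !zext_ord mulmxA hX.
by rewrite !l0 mul0mx mulmx0 scale0r.
Qed.

Variable n : nat.
Hypothesis hk : (k : nat)%:Z = (dual_endpoint E W)%:Z + n%:Z.

(** As R* E_{k-1} v = E_k A* E_{k-1} v, this is the entry of row k = t + n left of the diagonal.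
    Likewise a*_n is the diagonal entry and b*_n the one to its right. *)
Lemma dual_cE : dual_c Y x E W n = zext Xk (k%:Z - 1).
Proof.
rewrite /dual_c -hk; apply: dual_scalarE; first by rewrite zext_ord.
by rewrite (dual_sum_idem (fun a : int => a + 1)) subrK zext_ord zX.
Qed.

Lemma dual_aE : dual_a Y x E W n = Xk k.
Proof.
rewrite /dual_a -hk; apply: dual_scalarE; first by rewrite zext_ord.
rewrite [in RHS]zext_ord -[Xk k]zext_ord -zX -[E k in RHS]zext_ord.
rewrite -(dual_sum_idem id); congr (_ *m _).
by apply: eq_bigr => i _; rewrite zext_ord.
Qed.

Lemma dual_bE : dual_b Y x E W n = zext Xk (k%:Z + 1).
Proof.
rewrite /dual_b -hk; apply: dual_scalarE; first by rewrite zext_ord.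
by rewrite (dual_sum_idem (fun a : int => a - 1)) addrK zext_ord zX.
Qed.
End DualScalars.
End Idempotents.
End AssociationScheme.

Lemma zext_mul (R : pzSemiRingType) (D : nat) (f g : 'I_D.+1 -> R) (k : int) :
  zext (fun i => f i * g i) k = zext f k * zext g k.
Proof.
by rewrite /zext; case: k => [n|n]; rewrite ?mulr0 //; case: insub => [i|]; rewrite ?mulr0.
Qed.

(** * Dual intersection numbers *)

(** The equations are the weighted sums of row t + n of the matrix of A*. The bounds on [d] keep r +
    1 and r + 2 within [0, D]. The same [mu] serves every [n], which permits its elimination. *)
Lemma dual_intersection_relations (C : numClosedFieldType) (X : finType) (D : nat)
  (Y : assoc_scheme X D) (E : 'I_D.+1 -> 'M[C]_#|X|)
  (q : 'I_D.+1 -> 'I_D.+1 -> 'I_D.+1 -> C) (theta thetas : 'I_D.+1 -> C)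
  (x : X) (W : {vspace 'cV[C]_#|X|})
  (c := dual_c Y x E W) (a := dual_a Y x E W) (b := dual_b Y x E W)
  (r := endpoint Y x W) (t := dual_endpoint E W) (d := diameter Y x W) :
  (0 < D)%N -> P_polynomial Y -> almost_bipartite Y ->
  primitive_idempotents Y E -> krein_parameters E q -> polynomial_numbers q ->
  (forall i, adj_mx C Y *m E i = theta i *: E i) ->
  (forall i, dual_adj_mx x E *m dual_idem C Y x i = thetas i *: dual_idem C Y x i) ->
  irreducible_T_module Y x W ->
  [/\ (r + d <= D)%N, (t + d <= D)%N, c 0%N = 0, b d = 0 &
  exists mu, forall n, (n <= d)%N -> let k := t%:Z + n%:Z in
   [/\ c n + a n + b n = zext thetas r%:Z,
       (1 <= d)%N -> zext theta (k - 1) * c n + zext theta k * a n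
         + zext theta (k + 1) * b n = zext thetas (r%:Z + 1) * zext theta k &
       (2 <= d)%N -> zext theta (k - 1) ^+ 2 * c n + zext theta k ^+ 2 * a n
         + zext theta (k + 1) ^+ 2 * b n = zext thetas (r%:Z + 2) * zext theta k ^+ 2
           + (zext thetas r%:Z - zext thetas (r%:Z + 2)) * mu]].
Proof.
move=> D_gt0 hP hAB hE hq hQ htheta hthetas [hT W0 hirr].
pose Es := dual_idem C Y x.
have [_ E_mul E_sum _] := hE.
have Es_mul := dual_idem_mul C Y x; have Es_sum := dual_idem_sum C Y x.
have [WE WEs] := (T_module_stable hE x W).1 hT.
have [w wW w0] : exists2 w, w \in W & w != 0.
  by exists (vpick W); rewrite ?memv_pick // vpick0; apply/eqP.
have [|r0 [rE /mx_img_neq0P W_r r_min]] :=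
    find_enum_ord (p := fun i => mx_img (Es i) W != 0%VS).
  apply/existsP; apply: contraNT w0; rewrite negb_exists => /forallP h.
  rewrite (idem_sum Es_sum w) big1 // => i _; apply/eqP.
  by apply: contraNT (h i) => i0; apply/mx_img_neq0P; exists w.
have [|t0 [tE /mx_img_neq0P W_t t_min]] :=
    find_enum_ord (p := fun i => mx_img (E i) W != 0%VS).
  apply/existsP; apply: contraNT w0; rewrite negb_exists => /forallP h.
  rewrite (idem_sum E_sum w) big1 // => i _; apply/eqP.
  by apply: contraNT (h i) => i0; apply/mx_img_neq0P; exists w.
have W_lt_r (i : 'I_D.+1) u : (i < r0)%N -> u \in W -> Es i *m u = 0.
  move=> /r_min h uW; apply/eqP; apply: contraNT h => i0.
  by apply/mx_img_neq0P; exists u.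
have W_lt_t (i : 'I_D.+1) u : (i < t0)%N -> u \in W -> E i *m u = 0.
  move=> /t_min h uW; apply/eqP; apply: contraNT h => i0.
  by apply/mx_img_neq0P; exists u.
have W_irr (U : {vspace 'cV[C]_#|X|}) : (U <= W)%VS ->
    (forall i, mxstable (E i) U) -> (forall i, mxstable (Es i) U) -> U = 0%VS \/ U = W.
  by move=> UW UE UEs; apply: hirr => //; apply/(T_module_stable hE).
have triE (k l : 'I_D.+1) : (k.+1 < l)%N || (l.+1 < k)%N ->
    E k *m dual_adj_mx x E *m E l = 0 by exact: (idem_dual_adj_idem_eq0 hE x D_gt0 hq hQ).
have triEs (i j : 'I_D.+1) : [|| (i.+1 < j)%N, (j.+1 < i)%N | (i == j) && (i < D)%N] ->
    Es i *m adj_mx C Y *m Es j = 0 by exact: dual_idem_adj_dual_idem_eq0.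
have [v [u [m [Xs [mu]]]]] := tridiagonal_module_structure
  (adj_mx_sum hE htheta) (dual_adj_mx_sum hthetas) D_gt0 E_mul E_sum Es_mul Es_sum
  (theta_inj hE htheta D_gt0 hP) (thetas_inj hE D_gt0 hq hQ hthetas)
  triE triEs
  WE WEs W_irr W_r W_lt_r W_t W_lt_t.
case=> [[vW v0 rv rline] [uW uline cardu] [tm supp] [hX X0] rel].
have rE' : r = r0 by exact: rE.
have tE' : t = t0 by exact: tE.
have suppd : [set i | mx_img (Es i) W != 0%VS] = [set i | Es i *m u != 0].
  apply/setP => i; rewrite !inE; apply/mx_img_neq0P/idP => [[w' w'W]|i0]; last by exists u.
  by apply: contra => /eqP i0; have := uline i _ w'W; rewrite i0 => /vlineP [? ->]; rewrite scaler0.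
have dE : d = (m - t0)%N by rewrite /d /diameter -/Es suppd cardu subn1.
(* The [d + 1] indices with E*_i W nonzero lie between [r] and [D]. *)
have rd : (r + d <= D)%N.
  have : (#|[set i | mx_img (Es i) W != 0%VS]| <= #|[set i : 'I_D.+1 | (r0 <= i < D.+1)%N]|)%N.
    apply/subset_leq_card/subsetP => i; rewrite !inE ltn_ord andbT.
    by rewrite leqNgt; apply: contraL => /r_min.
  rewrite suppd cardu -sum1dep_card -(big_ord_widen_cond _ (fun i => r0 <= i)%N (fun=> 1%N)) //.
  rewrite -(big_geq_mkord r0 D.+1 predT (fun=> 1%N)) sum_nat_const_nat muln1.
  by rewrite rE' dE; have := ltn_ord r0; lia.
have mD := ltn_ord m.
have td : (t + d <= D)%N by rewrite tE' dE; lia.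
pose kk n : 'I_D.+1 := inord (t + n).
have kkE n : (n <= d)%N -> (kk n : nat)%:Z = t%:Z + n%:Z.
  by move=> nd; rewrite inordK ?PoszD //; lia.
have k0 n : (n <= d)%N -> E (kk n) *m v != 0.
  by move=> nd; rewrite supp inordK; lia.
have cE n (nd : (n <= d)%N) : c n = zext (Xs (kk n)) ((kk n)%:Z - 1).
  by apply: (dual_cE hE (r := r0) (v := v)) => //; [exact: k0 | exact: kkE].
have aE n (nd : (n <= d)%N) : a n = Xs (kk n) (kk n).
  by apply: (dual_aE hE (r := r0) (v := v)) => //; [exact: k0 | exact: kkE].
have bE n (nd : (n <= d)%N) : b n = zext (Xs (kk n)) ((kk n)%:Z + 1).
  by apply: (dual_bE hE (r := r0) (v := v)) => //; [exact: k0 | exact: kkE].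
(* E_j v = 0 outside [t, t + d]; this yields c*_0 = 0 and b*_d = 0. *)
have X0' n (j : int) : (n <= d)%N -> j < t%:Z \/ t%:Z + d%:Z < j -> zext (Xs (kk n)) j = 0.
  move=> nd hj; have [[i ij]|->//] := zextP D j.
  rewrite ij zext_ord X0 //; apply/or4P; apply: Or44.
  by rewrite -[_ == _]negbK supp; lia.
split=> //.
- by rewrite cE // X0' // kkE //; left; lia.
- by rewrite bE // X0' // kkE //; right; lia.
exists mu => n nd k; have [rel0 rel1 rel2] := rel _ (k0 n nd).
have tri (f : 'I_D.+1 -> C) : \sum_l f l * Xs (kk n) l =
    zext f (k - 1) * c n + zext f k * a n + zext f (k + 1) * b n.
  rewrite (sum_tridiagonal (k := kk n)) => [|l far]; last first.
    by rewrite X0 ?mulr0 //; apply/or4P; case/orP: far; [apply: Or41 | apply: Or42].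
  by rewrite !zext_mul cE // aE // bE // /k -kkE // zext_ord.
split.
- rewrite rE' zext_ord -rel0 (sum_tridiagonal (k := kk n)) ?cE ?aE ?bE // => l far.
  by apply: X0; apply/or4P; case/orP: far; [apply: Or41 | apply: Or42].
- move=> d1; pose s : 'I_D.+1 := inord r0.+1.
  have sE : s = r0.+1 :> nat by rewrite inordK //; lia.
  rewrite -tri (rel1 s sE) /k -kkE // zext_ord; congr (_ * _).
  by rewrite -[thetas s]zext_ord sE rE' -addn1 PoszD.
move=> d2; pose s : 'I_D.+1 := inord r0.+2.
have sE : s = r0.+2 :> nat by rewrite inordK //; lia.
have zsq (j : int) : zext (fun l => theta l ^+ 2) j = zext theta j ^+ 2 by exact: zext_mul.
rewrite -!zsq -tri (rel2 s sE) /k -kkE // zext_ord rE' zext_ord.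
by rewrite -[thetas s]zext_ord sE -addn2 PoszD.
Qed.

(** [p], [s], [n] stand for theta_{k-1}, theta_k, theta_{k+1}, and [s0], [s1] for theta_t,
    theta_{t+1}. Combining the equations of row k with the coefficients of (z - s)(z - n) kills [a]
    and [b]. The term in [mu] cancels against the combination of row t given by (z - s0)(z - s1),
    whose left side is 0 as c*_0 = 0. *)
Lemma dual_c_interior (F : fieldType) (c a b p s n z0 z1 z2 a0 b0 s0 s1 mu : F) :
  c + a + b = z0 -> p * c + s * a + n * b = z1 * s ->
  p ^+ 2 * c + s ^+ 2 * a + n ^+ 2 * b = z2 * s ^+ 2 + (z0 - z2) * mu ->
  a0 + b0 = z0 -> s0 * a0 + s1 * b0 = z1 * s0 ->
  s0 ^+ 2 * a0 + s1 ^+ 2 * b0 = z2 * s0 ^+ 2 + (z0 - z2) * mu ->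
  p != s -> p != n ->
  c = ((s ^+ 2 - s0 ^+ 2) * (z2 - z1) + (s0 * s1 - s * n) * (z1 - z0))
      / ((p - s) * (p - n)).
Proof.
move=> e0 e1 e2 f0 f1 f2 ps pn.
have den0 : (p - s) * (p - n) != 0 by rewrite mulf_neq0 ?subr_eq0.
apply: (mulIf den0); rewrite divfK //.
have -> : c * ((p - s) * (p - n)) =
    (p ^+ 2 * c + s ^+ 2 * a + n ^+ 2 * b) - (s + n) * (p * c + s * a + n * b)
    + s * n * (c + a + b)
    - ((s0 ^+ 2 * a0 + s1 ^+ 2 * b0) - (s0 + s1) * (s0 * a0 + s1 * b0)
       + s0 * s1 * (a0 + b0)) by ring.
by rewrite e0 e1 e2 f0 f1 f2; ring.
Qed.

(** With one neighbour missing, two equations suffice: z - s kills [a]. This serves both c*_d and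
    b*_0. *)
Lemma dual_c_end (F : fieldType) (c a p s z0 z1 : F) :
  c + a = z0 -> p * c + s * a = z1 * s -> p != s -> c = s * (z1 - z0) / (p - s).
Proof.
move=> e0 e1 ps; have den0 : p - s != 0 by rewrite subr_eq0.
apply: (mulIf den0); rewrite divfK //.
have -> : c * (p - s) = (p * c + s * a) - s * (c + a) by ring.
by rewrite e0 e1; ring.
Qed.

(** * Closed formulas and their reality *)

Local Open Scope complex_scope.

Theorem theorem12p4 (R : realType) (X : finType) (D : nat)
  (Y : assoc_scheme X D)
  (E : 'I_D.+1 -> 'M[R[i]]_#|X|)
  (q : 'I_D.+1 -> 'I_D.+1 -> 'I_D.+1 -> R[i])
  (theta thetas : 'I_D.+1 -> R[i])
  (x : X) (W : {vspace 'cV[R[i]]_#|X|}) (r t d : nat)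
  (hD : (3 <= D)%N)
  (hP : P_polynomial Y)
  (hAB : almost_bipartite Y)
  (hE : primitive_idempotents Y E)
  (hq : krein_parameters E q)
  (hQ : polynomial_numbers q)
  (htheta : forall i, adj_mx _ Y *m E i = theta i *: E i)
  (hthetas : forall i,
     dual_adj_mx x E *m dual_idem _ Y x i = thetas i *: dual_idem _ Y x i)
  (hW : irreducible_T_module Y x W)
  (hr : r = endpoint Y x W)
  (ht : t = dual_endpoint E W)
  (hd : d = diameter Y x W) :
  let th (k : int) := zext theta k in
  let ths (k : int) := zext thetas k in
  let c := dual_c Y x E W in
  let a := dual_a Y x E W in
  let b := dual_b Y x E W in
  let r := r%:Z in
  let t := t%:Z in
  (d = 0%N -> [/\ c 0%N = 0, a 0%N = ths r & b 0%N = 0]) /\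
  ((1 <= d)%N ->
    [/\ c 0%N = 0,
        forall n : nat, (1 <= n <= d - 1)%N -> let i := n%:Z in
          c n = ((th (t + i) ^+ 2 - th t ^+ 2) * (ths (r + 2) - ths (r + 1))
                 + (th t * th (t + 1) - th (t + i) * th (t + i + 1))
                   * (ths (r + 1) - ths r))
                / ((th (t + i - 1) - th (t + i))
                   * (th (t + i - 1) - th (t + i + 1)))
      & c d = th (t + d%:Z) * (ths (r + 1) - ths r)
              / (th (t + d%:Z - 1) - th (t + d%:Z))] /\
    [/\ b 0%N = th t * (ths r - ths (r + 1)) / (th t - th (t + 1)),
        forall n : nat, (1 <= n <= d - 1)%N -> let i := n%:Z in
          b n = ((th (t + i) ^+ 2 - th t ^+ 2) * (ths (r + 2) - ths (r + 1))
                 + (th t * th (t + 1) - th (t + i) * th (t + i - 1))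
                   * (ths (r + 1) - ths r))
                / ((th (t + i + 1) - th (t + i))
                   * (th (t + i + 1) - th (t + i - 1)))
      & b d = 0] /\
    (forall n : nat, (n <= d)%N -> a n = ths r - b n - c n)) /\
  (forall n : nat, (n <= d)%N ->
    [/\ c n \is Num.real, a n \is Num.real & b n \is Num.real]).
Proof.
have D_gt0 : (0 < D)%N by apply: leq_trans hD.
have [] := dual_intersection_relations D_gt0 hP hAB hE hq hQ htheta hthetas hW.
rewrite -hr -ht -hd => rd td c0 bd [mu rel] th ths c a b rz tz.
have th_neq (j k : int) : 0 <= j <= D%:Z -> 0 <= k <= D%:Z -> j != k -> th j != th k.
  case: j k => [j|//] [k|//] jD kD; apply: contra => /eqP.
  have jE : (inord j : 'I_D.+1)%:Z = j%:Z by rewrite inordK //; lia.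
  have kE : (inord k : 'I_D.+1)%:Z = k%:Z by rewrite inordK //; lia.
  by rewrite -jE -kE /th !zext_ord => /(theta_inj hE htheta D_gt0 hP) ->.
have th_real j : th j \is Num.real.
  rewrite /th; case: (zextP D j) => [[i ->]|->]; rewrite ?zext_ord ?rpred0 //.
  exact: (theta_real hE htheta).
have ths_real j : ths j \is Num.real.
  rewrite /ths; case: (zextP D j) => [[i ->]|->]; rewrite ?zext_ord ?rpred0 //.
  exact: (thetas_real hE D_gt0 hthetas).
(* Row t, without its term in c*_0 = 0, is the reference row that eliminates [mu]. *)
have := rel 0%N (leq0n d); cbv zeta; rewrite addr0 c0 !mulr0 !add0r => rel0.
have aE n : (n <= d)%N -> a n = ths rz - b n - c n.
  by move=> /rel [+ _ _]; rewrite /ths /rz => <-; rewrite /a /b /c; ring.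
have interior n : (1 <= n <= d - 1)%N -> let i := n%:Z in
    c n = ((th (tz + i) ^+ 2 - th tz ^+ 2) * (ths (rz + 2) - ths (rz + 1))
           + (th tz * th (tz + 1) - th (tz + i) * th (tz + i + 1))
             * (ths (rz + 1) - ths rz))
          / ((th (tz + i - 1) - th (tz + i)) * (th (tz + i - 1) - th (tz + i + 1))) /\
    b n = ((th (tz + i) ^+ 2 - th tz ^+ 2) * (ths (rz + 2) - ths (rz + 1))
           + (th tz * th (tz + 1) - th (tz + i) * th (tz + i - 1))
             * (ths (rz + 1) - ths rz))
          / ((th (tz + i + 1) - th (tz + i)) * (th (tz + i + 1) - th (tz + i - 1))).
  move=> nd i; have [|e0 e1 e2] := rel n; first by lia.
  have [f0 f1 f2] := rel0; have d1 : (1 <= d)%N by lia. have d2 : (2 <= d)%N by lia.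
  have {}e1 := e1 d1; have {}e2 := e2 d2; have {}f1 := f1 d1; have {}f2 := f2 d2.
  split.
    by apply: dual_c_interior e0 e1 e2 f0 f1 f2 _ _; apply: th_neq; rewrite /tz; lia.
  (* Reversing the sums exchanges c*_n with b*_n and theta_{k-1} with theta_{k+1}. *)
  have rev (u v w : R[i]) : u + v + w = w + v + u by rewrite addrC addrA addrAC.
  rewrite rev in e0; rewrite rev in e1; rewrite rev in e2.
  by apply: dual_c_interior e0 e1 e2 f0 f1 f2 _ _; apply: th_neq; rewrite /tz; lia.
have cdE : (1 <= d)%N ->
    c d = th (tz + d%:Z) * (ths (rz + 1) - ths rz) / (th (tz + d%:Z - 1) - th (tz + d%:Z)).
  move=> d1; have [] := rel d (leqnn d); rewrite bd !mulr0 !addr0 => e0 /(_ d1) e1 _.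
  by apply: dual_c_end e0 e1 _; apply: th_neq; rewrite /tz; lia.
have b0E : (1 <= d)%N -> b 0%N = th tz * (ths rz - ths (rz + 1)) / (th tz - th (tz + 1)).
  move=> d1; have [e0 /(_ d1) e1 _] := rel0; rewrite addrC in e0; rewrite addrC in e1.
  (* The only neighbour of row t is t + 1, which takes the place of the preceding index in the end
     formula. *)
  have -> : b 0%N = th tz * (ths (rz + 1) - ths rz) / (th (tz + 1) - th tz).
    by apply: dual_c_end e0 e1 _; apply: th_neq; rewrite /tz; lia.
  by rewrite -[ths (rz + 1) - _]opprB -[th (tz + 1) - _]opprB invrN -!mulrA mulrNN.
have cb_real n : (n <= d)%N -> (c n \is Num.real) && (b n \is Num.real).
  move=> nd; have [d0|d1] := posnP d.
    have n0 : n = 0%N by lia.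
    (* Here d = 0, so b*_0 is b*_d. *)
    by rewrite n0 /c c0 /b -[X in dual_b _ _ _ _ X]d0 bd !rpred0.
  have formula_real (u v w z : R[i]) : u \is Num.real -> v \is Num.real ->
      w \is Num.real -> z \is Num.real -> (u * v + w * z) \is Num.real.
    by move=> *; rewrite rpredD ?rpredM.
  have [->|n0] := posnP n.
    by rewrite /c c0 rpred0 b0E // rpredM ?rpredV ?rpredM ?rpredB.
  have [->|nd'] := eqVneq n d.
    by rewrite /b bd rpred0 cdE // andbT rpredM ?rpredV ?rpredM ?rpredB.
  have [|-> ->] := interior n; first by lia.
  by apply/andP; split; (apply: rpredM; [apply: formula_real | rewrite rpredV; apply: rpredM]);
    rewrite rpredB ?rpredX ?rpredM.
split.
  move=> d0; have b00 : b 0%N = 0 by rewrite -d0 /b bd.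
  split; [exact: c0 | | exact: b00].
  by rewrite (aE 0%N (leq0n d)) b00 /c c0 !subr0.
split.
  move=> d1; split.
    by split; [exact: c0 | move=> n /interior [] | exact: (cdE d1)].
  split; last exact: aE.
  by split; [exact: (b0E d1) | move=> n /interior [] | exact: bd].
move=> n nd; have /andP [cr br] := cb_real n nd.
split; [exact: cr | | exact: br].
rewrite (aE n nd); exact: rpredB (rpredB (ths_real rz) br) cr.
Qed.
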